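(* Let $\{\underline{X}_t\}_{t\in\mathbb{Z}}$ be a centred real $p$-dimensional time series ($p$ fixed) whose covariance operator satisfies $0<\lambda_{\inf}\le\lambda_{\sup}<\infty$ and whose inverse covariances satisfy $\sup_t\sum_{j\ne0}|j|^K\|{\bf D}_{t,t+j}\|_\infty<\infty$ for some $K\ge3/2$. Let $\Gamma_t^{(a,b)}(\omega)=\sum_{r\in\mathbb{Z}}[D_{a,b}]_{t,t+r}\exp(ir\omega)$. Then for all $1\le a,b\le p$ and $1\le k_1,k_2\le n$, with $\omega_k=2\pi k/n$, $$[{\bf K}_n(\omega_{k_1},\omega_{k_2})]_{a,b}=\frac1n\sum_{t=1}^n\Gamma_t^{(a,b)}(\omega_{k_2})\exp(-it(\omega_{k_1}-\omega_{k_2}))+O\left(\frac1n\right)=\left[\frac1n\sum_{t=1}^n\Gamma_t^{(b,a)}(\omega_{k_1})\exp(-it(\omega_{k_2}-\omega_{k_1}))\right]^*+O\left(\frac1n\right)$$ as $n\to\infty$, where $^*$ is complex conjugation and the $O(1/n)$ terms are uniform in $k_1,k_2$. Further, if $\{X_t^{(a)}\}$ and $\{X_t^{(b)}\}$ are conditionally stationary (i.e. $D_{a,a}$, $D_{b,b}$ and $D_{a,b}$ are Toeplitz; $a=b$ allowed), then $$[{\bf K}_n(\omega_{k_1},\omega_{k_2})]_{a,b}=\begin{cases}\Gamma^{(a,b)}(\omega_k)+O(n^{-1}) & k_1=k_2(=k)\\ O(n^{-1}) & k_1\ne k_2\end{cases}$$ where $\Gamma^{(a,b)}(\omega)=\s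um_{r=-\infty}^\infty[D_{a,b}]_{0,r}\exp(ir\omega)$.
   Context: Fix $p\ge1$. $\{\underline{X}_t\}_{t\in\mathbb{Z}}$, $\underline{X}_t=(X_t^{(1)},\dots,X_t^{(p)})'$, is a real-valued time series with mean zero and finite variances on a probability space; ${\bf C}_{t,\tau}=\mathrm{Cov}(\underline{X}_t,\underline{X}_\tau)$ is $p\times p$, with $\sup_t\|{\bf C}_{t,t}\|_\infty<\infty$ ($\|\cdot\|_\infty$ = largest absolute entry). $\ell_2$ is the Hilbert space of square-summable complex sequences indexed by $\mathbb{Z}$, and $\ell_{2,p}$ the Hilbert space of $v=\mathrm{vec}[u^{(1)},\dots,u^{(p)}]$ with $u^{(s)}\in\ell_2$, with inner product the sum of the $\ell_2$ inner products. $C=(C_{a,b})_{1\le a,b\le p}$ is the infinite block matrix with $[C_{a,b}]_{t,\tau}=[{\bf C}_{t,\tau}]_{a,b}$, acting on $\ell_{2,p}$ by matrix multiplication; $\lambda_{\sup}=\sup_{\|v\|_2=1}\langle v,Cv\rangle$ and $\lambda_{\inf}=\inf_{\|v\|_2=1}\langle v,Cv\rangle$ over $v\in\ell_{2,p}$. $\mathcal{H}$ is the closed linear span (in the $L^2$ space with inner product $\mathrm{Cov}$) of all $X_t^{(c)}$, $t\in\mathbb{Z}$, $1\le c\le p$; $P_{\mathcal{M}}$ is the orthogonal projection onto a closed subspace $\mathcal{M}$; $\mathcal{H}-X_t^{(a)}$ is the closed span of all $X_s^{(c)}$ with $(s,c)\ne(t,a)$. When $0<\lambda_{\inf}\le\lambda_{\sup}<\infty$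 there are unique coefficients with $P_{\mathcal{H}-X_t^{(a)}}(X_t^{(a)})=\sum_{\tau\in\mathbb{Z}}\sum_{b=1}^p\beta_{(\tau,b)\to(t,a)}X_\tau^{(b)}$, $\beta_{(t,a)\to(t,a)}=0$; put $\sigma_{a,t}^2=\mathrm{E}[X_t^{(a)}-P_{\mathcal{H}-X_t^{(a)}}(X_t^{(a)})]^2$. Define the $p\times p$ matrices ${\bf D}_{t,\tau}$ and infinite matrices $D_{a,b}$ by $[{\bf D}_{t,\tau}]_{a,b}=[D_{a,b}]_{t,\tau}=1/\sigma_{a,t}^2$ if $(a,t)=(b,\tau)$, and $=-\beta_{(\tau,b)\to(t,a)}/\sigma^2_{a,t}$ otherwise. An infinite matrix $A$ is Toeplitz if $A_{t,\tau}=a_{t-\tau}$ for some sequence $(a_r)_{r\in\mathbb{Z}}$. Finite sample objects: ${\bf X}_n=(X_1^{(1)},\dots,X_n^{(1)},\dots,X_1^{(p)},\dots,X_n^{(p)})'$, $C_n=\mathrm{Var}[{\bf X}_n]$. $F_n$ is the $np\times np$ block-diagonal matrix with $p$ diagonal blocks equal to the $n\times n$ unitary DFT matrix $\mathcal{F}_n$, where $[\mathcal{F}_n^*\underline{x}]_k=\frac1{\sqrt n}\sum_{t=1}^nx_t\exp(-it\omega_k)$, $k=1,\dots,n$. ${\bf K}_n=[\mathrm{Var}(F_n^*{\bf X}_n)]^{-1}=F_n^*C_n^{-1}F_n$ (with $\mathrm{Var}(Z)=\mathrm{E}[ZZ^*]$); $[{\bf K}_n(\omega_{k_1},\omega_{k_2})]_{a,b}$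 is the $(k_1,k_2)$ entry of the $(a,b)$-th $n\times n$ block of ${\bf K}_n$. *)

(* Defs.v *)
From HB Require Import structures.
From mathcomp Require Import all_boot all_order all_algebra complex.
From mathcomp Require Import all_classical all_reals all_analysis.

Set Implicit Arguments.
Unset Strict Implicit.
Unset Printing Implicit Defensive.

Import Order.TTheory GRing.Theory Num.Theory.
Import numFieldNormedType.Exports.

Local Open Scope classical_set_scope.
Local Open Scope ring_scope.
Local Open Scope complex_scope.

Section TwoSidedSeries.
Variable R : realType.

(* Two-sided series are limits of symmetric partial sums
   \sum_(-N <= k <= N) f k. The value is unspecified on divergence. *)
Definition zpartial (V : nmodType) (f : int -> V) (N : nat) : V :=
  \sum_(i < N.*2.+1) f (i%:Z - N%:Z).

Definition zsum (f : int -> R[i]) : R[i] :=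
  lim ((zpartial f N : (R[i])^o) @[N --> \oo]).

Definition cis (x : R) : R[i] := cos x +i* sin x.

End TwoSidedSeries.

Section HilbertSpace.
Variables (R : realType) (p : nat).

(* v = vec[u^(1),...,u^(p)], a family of complex numbers indexed by
   Z x {1,...,p}; v t s is the t-th coordinate of u^(s). *)
Definition zvec := int -> 'I_p -> R[i].

Definition inner (u v : zvec) : R[i] :=
  \sum_(s < p) zsum (fun t => (u t s)^* * v t s).

(* Squared norm, equal to +oo exactly when v is not in l_{2,p}. *)
Definition norm2sq (v : zvec) : \bar R :=
  (\sum_(s < p) \esum_(t in [set: int]) (Normc.normc (v t s) ^+ 2)%:E)%E.

Definition unit_sphere : set zvec := [set v | norm2sq v = 1%E].

(* A : int -> int -> 'M_p encodes the block matrix (A_{a,b}) through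
   [A_{a,b}]_{t,tau} = A t tau a b. *)
Definition blockmul (A : int -> int -> 'M[R]_p) (v : zvec) : zvec :=
  fun t a => zsum (fun tau => \sum_(b < p) (A t tau a b)%:C * v tau b).

(* For symmetric A the value <v, A v> is real, hence the real part. If the
   supremum over the finitely supported unit vectors is finite and A is
   positive semidefinite, A is a bounded operator and all series involved
   converge. *)
Definition quadform (A : int -> int -> 'M[R]_p) (v : zvec) : R :=
  complex.Re (inner v (blockmul A v)).

Definition lambda_sup (A : int -> int -> 'M[R]_p) : \bar R :=
  ereal_sup [set (quadform A v)%:E | v in unit_sphere].

Definition lambda_inf (A : int -> int -> 'M[R]_p) : \bar R :=
  ereal_inf [set (quadform A v)%:E | v in unit_sphere].

Definition toeplitz (A : int -> int -> R) :=
  exists a : int -> R, forall t tau, A t tau = a (t - tau).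

End HilbertSpace.

Section L2Space.
Context d (T : measurableType d) (R : realType) (P : probability T R).

Definition cov (Y Z : T -> R) : R := fine (covariance P Y Z).

(* Centred square integrable variables; on these Cov is the L^2 inner
   product. Elements are functions, equality in L^2 is a.s. equality. *)
Definition centredL2 : set (T -> R) :=
  [set Y | Y \in Lfun P 2%:E /\ 'E_P[Y]%E = 0%E].

Definition lin_span (A : set (T -> R)) : set (T -> R) :=
  [set Y | exists (m : nat) (c : 'I_m -> R) (f : 'I_m -> T -> R),
     (forall i, A (f i)) /\ Y = (fun w => \sum_(i < m) c i * f i w)].

Definition closed_span (A : set (T -> R)) : set (T -> R) :=
  [set Y | centredL2 Y /\
     forall e : R, 0 < e -> exists2 Z, lin_span A Z & cov (Y \- Z) (Y \- Z) < e].

(* Y is a version of P_M Z. *)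
Definition is_orth_proj (M : set (T -> R)) (Z Y : T -> R) :=
  M Y /\ forall W, M W -> cov (Z \- Y) W = 0.

(* \sum_(k in Z) f k = Y in L^2. *)
Definition L2_zsum (f : int -> T -> R) (Y : T -> R) :=
  (cov (Y \- zpartial f N) (Y \- zpartial f N) @[N --> \oo]) --> (0 : R).

End L2Space.

Section TimeSeries.
Context d (T : measurableType d) (R : realType) (P : probability T R).
Variable p : nat.
Variable X : int -> 'I_p -> T -> R.

Definition Cov_mx (t tau : int) : 'M[R]_p :=
  \matrix_(a, b) cov P (X t a) (X tau b).

Definition span_without (t : int) (a : 'I_p) : set (T -> R) :=
  closed_span P [set X sc.1 sc.2 | sc in [set sc | sc <> (t, a)]].

(* proj t a is (a version of) the projection of X_t^(a) on H - X_t^(a). *)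
Definition is_projection_family (proj : int -> 'I_p -> T -> R) :=
  forall t a, is_orth_proj P (span_without t a) (X t a) (proj t a).

(* beta tau b t a stands for beta_{(tau,b) -> (t,a)}. *)
Definition is_projection_coef (proj : int -> 'I_p -> T -> R)
    (beta : int -> 'I_p -> int -> 'I_p -> R) :=
  forall t a, beta t a t a = 0 /\
    L2_zsum P (fun tau w => \sum_(b < p) beta tau b t a * X tau b w)
              (proj t a).

Definition sigma2 (proj : int -> 'I_p -> T -> R) (a : 'I_p) (t : int) : R :=
  fine ('E_P[fun w => ((X t a w - proj t a w) ^+ 2)%R])%E.

Definition invcov (proj : int -> 'I_p -> T -> R)
    (beta : int -> 'I_p -> int -> 'I_p -> R) (t tau : int) : 'M[R]_p :=
  \matrix_(a, b) if (a, t) == (b, tau) then (sigma2 proj a t)^-1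
                 else - beta tau b t a / sigma2 proj a t.

End TimeSeries.

Section Blocks.
Variables (R : realType) (p : nat).
Variable D : int -> int -> 'M[R]_p.

Definition infblock (a b : 'I_p) (t tau : int) : R := D t tau a b.

Definition Gamma (t : int) (a b : 'I_p) (omega : R) : R[i] :=
  zsum (fun r => (infblock a b t (t + r))%:C * cis (r%:~R * omega)).

Definition cond_stationary (a b : 'I_p) :=
  [/\ toeplitz (infblock a a), toeplitz (infblock b b)
    & toeplitz (infblock a b)].

End Blocks.

Section FiniteSample.
Context d (T : measurableType d) (R : realType) (P : probability T R).

(* Ordinals k : 'I_n stand for the 1-based indices k.+1 = 1, ..., n. *)
Definition freq (n : nat) (k : 'I_n) : R := 2 * pi * k.+1%:R / n%:R.

Definition adjoint m n (A : 'M[R[i]]_(m, n)) : 'M[R[i]]_(n, m) :=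
  map_mx Num.conj A^T.

Definition DFT (n : nat) : 'M[R[i]]_n :=
  \matrix_(t < n, k < n) ((Num.sqrt n%:R)^-1%:C * cis (t.+1%:R * freq k)).

Definition Cexpectation (Z : T -> R[i]) : R[i] :=
  (fine 'E_P[fun w => complex.Re (Z w)]%E) +i*
  (fine 'E_P[fun w => complex.Im (Z w)]%E).

(* Var(Z) = E[Z Z^*], for a centred complex random vector Z. *)
Definition Var (m : nat) (Z : T -> 'cV[R[i]]_m) : 'M[R[i]]_m :=
  \matrix_(i, j) Cexpectation (fun w => (Z w *m adjoint (Z w)) i j).

Variables (p : nat) (X : int -> 'I_p -> T -> R).

(* X_n, stacked component by component, with entries seen in R[i]. *)
Definition sample (n : nat) (w : T) : 'cV[R[i]]_(\sum_(a < p) n) :=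
  \mxcol_(a < p) \col_(t < n) (X t.+1%:Z a w)%:C.

Definition blockDFT (n : nat) : 'M[R[i]]_(\sum_(a < p) n) :=
  \mxdiag_(a < p) DFT n.

Definition Kmx (n : nat) : 'M[R[i]]_(\sum_(a < p) n) :=
  invmx (Var (fun w => adjoint (blockDFT n) *m sample n w)).

Definition Kentry (n : nat) (k1 k2 : 'I_n) (a b : 'I_p) : R[i] :=
  submxblock (Kmx n) a b k1 k2.

End FiniteSample.

Section Approximation.
Variables (R : realType) (p : nat) (D : int -> int -> 'M[R]_p).

Definition Gamma_avg (n : nat) (a b : 'I_p) (k l : 'I_n) : R[i] :=
  n%:R^-1 * \sum_(t < n) Gamma D t.+1%:Z a b (freq R l) *
                         cis (- (t.+1%:R * (freq R k - freq R l))).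

End Approximation.

(* Main.v *)
Require Import Defs.
From HB Require Import structures.
From mathcomp Require Import all_boot all_order all_algebra complex.
From mathcomp Require Import all_classical all_reals all_analysis.
From mathcomp Require Import zify ring lra.

Set Implicit Arguments.
Unset Strict Implicit.
Unset Printing Implicit Defensive.

Import Order.TTheory GRing.Theory Num.Theory.
Import numFieldNormedType.Exports.

Local Open Scope classical_set_scope.
Local Open Scope ring_scope.
Local Open Scope complex_scope.

(** The covariances of the series are handled in the real pre-Hilbert space of
  centred square integrable variables, with inner product B = Cov. Write i for
  an index (t, a) and x_i for X_t^(a). The normalised innovations
  z_i = (x_i - proj x_i) / sigma_i^2 are biorthogonal to the x_j, and
  z_i = sum_j D_ij x_j in L^2; pairing that expansion with z_j gives
  D_ij = B(z_i, z_j), so the inverse covariances form a Gram matrix and are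
  symmetric ([dual_gram]).

  Let Q be the inverse of the covariance matrix C_n of x_1, ..., x_n, and put
  w_i = sum_(j <= n) Q_ij x_j. Both z_i and w_i are dual to the sample, hence
  e_i = z_i - w_i is orthogonal to it, and
  B(e_i, e_j) = D_ij - Q_ij ([dual_err_gram]): the error made in replacing
  C_n^-1 by the n-section of D is itself a Gram matrix. For bounded weights f,
  the vector sum_i f_i e_i is what is left of u = sum_i f_i z_i after projection
  on the sample. Subtracting from u the in-sample part of its expansion can
  only leave more, and what it leaves is sum_(j > n or j < 1) g_j x_j with
  g_j = sum_i f_i D_ij. Its variance is at most lambda_sup times
  sum_j g_j^2, which the decay of D bounds uniformly in n
  ([dual_err_bound]). By Cauchy-Schwarz the bilinear form of D - Q is O(1) on
  bounded vectors ([inv_section_bound]).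

  An entry of K_n is 1/n times the bilinear form of Q on two vectors of complex
  exponentials ([Kentry_fourier]), so Q can be replaced by D at the cost
  O(1/n). The same form of D differs from the time average of the local spectra
  only in that each row sum is cut to the sample; the removed tails decay like
  the distance to the boundary to the power -3/2, which is summable, so that
  they contribute O(1) before the division by n ([Gamma_avg_section]). The
  second approximation is the first one for the adjoint entry, as K_n is
  Hermitian, and for Toeplitz blocks the time average is a geometric sum
  ([Gamma_avg_toeplitz]). *)

(** * Windows of integers *)

(** The range of summation of [zpartial], as a sequence: windows can then be
  split, filtered and compared with arbitrary duplicate-free sequences. *)
Definition zwin (N : nat) : seq int := [seq i%:Z - N%:Z | i <- iota 0 N.*2.+1].

Lemma zwin_uniq N : uniq (zwin N).
Proof. by rewrite map_inj_uniq ?iota_uniq // => i j /addIr []. Qed.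

Lemma mem_zwin N (t : int) : (t \in zwin N) = (absz t <= N)%N.
Proof.
apply/mapP/idP => [[i ]|tN].
  rewrite mem_iota add0n => /andP[_ iN] ->; lia.
exists `|(t + N%:Z)%R|%N; last lia.
by rewrite mem_iota add0n; lia.
Qed.

Lemma zpartialE (V : nmodType) (f : int -> V) N :
  zpartial f N = \sum_(t <- zwin N) f t.
Proof.
rewrite /zpartial /zwin big_map.
by rewrite -(big_mkord xpredT (fun i => f (i%:Z - N%:Z))) /index_iota subn0.
Qed.

Lemma sub_zwin (r : seq int) : exists N0, forall N, (N0 <= N)%N ->
  {subset r <= zwin N}.
Proof.
elim: r => [|t r [N0 IH]]; first by exists 0%N.
exists (maxn N0 `|t|%N) => N; rewrite geq_max => /andP[N0N tN] s.
by rewrite inE => /orP[/eqP ->|/(IH _ N0N)//]; rewrite mem_zwin.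
Qed.

(** * Positive forms on a real vector space *)

Section PreHilbert.
Variables (R : realType) (V : lmodType R) (B : V -> V -> R).
Hypothesis B_lin : forall a u v w, B (a *: u + v) w = a * B u w + B v w.
Hypothesis B_sym : forall u v, B u v = B v u.
Hypothesis B_psd : forall u, 0 <= B u u.

Lemma form0l v : B 0 v = 0.
Proof. by have := B_lin (-1) 0 0 v; rewrite scaler0 addr0; lra. Qed.
Lemma form0r v : B v 0 = 0. Proof. by rewrite B_sym form0l. Qed.
Lemma formDl u v w : B (u + v) w = B u w + B v w.
Proof. by rewrite -[u]scale1r B_lin mul1r scale1r. Qed.
Lemma formZl a u w : B (a *: u) w = a * B u w.
Proof. by rewrite -[a *: u]addr0 B_lin form0l addr0. Qed.
Lemma formNl u w : B (- u) w = - B u w.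
Proof. by rewrite -scaleN1r formZl mulN1r. Qed.
Lemma formBl u v w : B (u - v) w = B u w - B v w.
Proof. by rewrite formDl formNl. Qed.
Lemma formDr u v w : B w (u + v) = B w u + B w v.
Proof. by rewrite B_sym formDl !(B_sym w). Qed.
Lemma formZr a u w : B w (a *: u) = a * B w u.
Proof. by rewrite B_sym formZl !(B_sym w). Qed.
Lemma formNr u w : B w (- u) = - B w u.
Proof. by rewrite B_sym formNl !(B_sym w). Qed.
Lemma formBr u v w : B w (u - v) = B w u - B w v.
Proof. by rewrite formDr formNr. Qed.
Lemma form_suml I (r : seq I) (P : pred I) F w :
  B (\sum_(i <- r | P i) F i) w = \sum_(i <- r | P i) B (F i) w.
Proof. exact: (big_morph (B^~ w) (fun u v => formDl u v w) (form0l w)). Qed.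
Lemma form_sumr I (r : seq I) (P : pred I) F w :
  B w (\sum_(i <- r | P i) F i) = \sum_(i <- r | P i) B w (F i).
Proof. exact: (big_morph (B w) (fun u v => formDr u v w) (form0r w)). Qed.

(** Definiteness is not available: two variables that agree almost surely are
  distinct functions. The case [B v v = 0] is therefore treated on its own. *)
Lemma form_CS u v : B u v ^+ 2 <= B u u * B v v.
Proof.
have q t : 0 <= B u u + 2 * t * B u v + t ^+ 2 * B v v.
  have := B_psd (u + t *: v).
  rewrite !formDl !formDr !formZl !formZr (B_sym v u); lra.
have [v0|v0] := eqVneq (B v v) 0.
  rewrite v0 mulr0.
  have [->|b0] := eqVneq (B u v) 0; first by rewrite expr0n.
  have := q (- (B u u + 1) / (2 * B u v)); rewrite v0 mulr0 addr0.
  have -> : 2 * (- (B u u + 1) / (2 * B u v)) * B u v = - (B u u + 1) by field.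
  lra.
have vp : 0 < B v v by rewrite lt0r v0 B_psd.
have := q (- B u v / B v v).
have -> : B u u + 2 * (- B u v / B v v) * B u v + (- B u v / B v v) ^+ 2 * B v v
   = (B u u * B v v - B u v ^+ 2) / B v v by field.
rewrite pmulr_lge0 ?invr_gt0//; lra.
Qed.

Lemma form_parallelogram u v : B (u + v) (u + v) <= 2 * B u u + 2 * B v v.
Proof.
have := B_psd (u - v).
rewrite !formDl !formDr !formNl !formNr (B_sym v u); lra.
Qed.

(** Strong convergence for the seminorm [B u u], the mode of convergence of the
  two-sided series that expand projections. *)
Definition form_cvg (u_ : nat -> V) (u : V) :=
  (B (u - u_ N) (u - u_ N) @[N --> \oo]) --> (0 : R).

(** Cauchy-Schwarz makes pairing with a fixed vector continuous. *)
Lemma form_cvg_pair u_ u v : form_cvg u_ u -> (B (u_ N) v @[N --> \oo]) --> B u v.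
Proof.
move=> uu; apply/cvgrPdist_lt => e e0.
have vp : 0 < B v v + 1 by rewrite ltr_wpDl ?B_psd.
have d0 : 0 < e ^+ 2 / (B v v + 1) by rewrite divr_gt0 ?exprn_gt0.
near=> N.
have : `|0 - B (u - u_ N) (u - u_ N)| < e ^+ 2 / (B v v + 1).
  by near: N; move/cvgrPdist_lt : uu; apply.
rewrite sub0r normrN ger0_norm ?B_psd// ltr_pdivlMr// => h.
rewrite -formBl -(ltr_pXn2r (n:=2)) ?nnegrE ?(ltW e0)// real_normK ?num_real//.
apply: le_lt_trans (form_CS _ _) _; apply: le_lt_trans h.
by apply: ler_wpM2l; rewrite ?B_psd// lerDl.
Unshelve. all: by end_near. Qed.

Lemma form_cvg_sq u_ u : form_cvg u_ u ->
  (B (u_ N) (u_ N) @[N --> \oo]) --> B u u.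
Proof.
move=> uu; have h := form_cvg_pair (v := u) uu.
have -> : (fun N => B (u_ N) (u_ N)) =
  (fun N => 2 * B (u_ N) u - B u u + B (u - u_ N) (u - u_ N)).
  by apply/funext => N; rewrite !formBl !formBr (B_sym u (u_ N)); ring.
rewrite [X in _ --> X](_ : _ = 2 * B u u - B u u + 0); last by ring.
apply: cvgD; last exact: uu.
by apply: cvgB; [apply: cvgMl_tmp; exact: h|exact: cvg_cst].
Qed.

Lemma form_cvg_scale (a : R) u_ u v_ v : form_cvg u_ u ->
  (\forall N \near \oo, v - v_ N = a *: (u - u_ N)) -> form_cvg v_ v.
Proof.
move=> uu h; rewrite /form_cvg.
suff : (a ^+ 2 * B (u - u_ N) (u - u_ N) @[N --> \oo]) --> (0 : R).
  apply: cvg_trans; apply: near_eq_cvg; near=> N.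
  have -> : v - v_ N = a *: (u - u_ N) by near: N; exact: h.
  by rewrite formZl formZr; ring.
by rewrite -[X in _ --> X](mulr0 (a ^+ 2)); apply: cvgMl_tmp.
Unshelve. all: by end_near. Qed.

Lemma form_cvg_sum (I : finType) (f : I -> R) (u_ : I -> nat -> V) (u : I -> V) :
  (forall i, form_cvg (u_ i) (u i)) ->
  form_cvg (fun N => \sum_i f i *: u_ i N) (\sum_i f i *: u i).
Proof.
move=> uu; rewrite /form_cvg.
have h (r : seq I) : (B (\sum_(i <- r) f i *: (u i - u_ i N))
         (\sum_(i <- r) f i *: (u i - u_ i N)) @[N --> \oo]) --> (0 : R).
  elim: r => [|i r IH].
    under eq_fun do rewrite big_nil form0l; exact: cvg_cst.
  apply: (@squeeze_cvgr _ _ _ _ (cst 0)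
   (fun N => 2 * (f i ^+ 2 * B (u i - u_ i N) (u i - u_ i N)) +
     2 * B (\sum_(i <- r) f i *: (u i - u_ i N))
         (\sum_(i <- r) f i *: (u i - u_ i N)))).
  - apply: nearW => N; rewrite B_psd big_cons /=.
    apply: le_trans (form_parallelogram _ _) _.
    by rewrite formZl formZr; lra.
  - exact: cvg_cst.
  - rewrite -[X in _ --> X](addr0 0) -{1}(mulr0 2) -{1}(mulr0 (f i ^+ 2)).
    rewrite -[X in _ --> _ + X](mulr0 2).
    by apply: cvgD; apply: cvgMl_tmp; [apply: cvgMl_tmp; exact: (uu i)|exact: IH].
have -> // : (fun N => B (\sum_i f i *: u i - \sum_i f i *: u_ i N)
     (\sum_i f i *: u i - \sum_i f i *: u_ i N)) =
   (fun N => B (\sum_i f i *: (u i - u_ i N)) (\sum_i f i *: (u i - u_ i N))).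
apply/funext => N; rewrite -sumrB.
by under eq_bigr do rewrite -scalerBr.
Qed.

(** * Biorthogonal families and sections of the inverse Gram matrix *)

Section Biorthogonal.
Variables (p : nat) (x z : int -> 'I_p -> V) (D : int -> int -> 'M[R]_p).
Hypothesis zx : forall t a tau b, B (z t a) (x tau b) = ((t, a) == (tau, b))%:R.
Hypothesis zD : forall t a,
  form_cvg (zpartial (fun tau => \sum_b D t tau a b *: x tau b)) (z t a).

(** Only one term of the expansion of [z t a] pairs with [z tau b]. *)
Lemma dual_gram t a tau b : B (z t a) (z tau b) = D t tau a b.
Proof.
have /cvg_unique h := form_cvg_pair (v := z tau b) (@zD t a).
apply: (h (@Rhausdorff R)).
apply: cvg_near_cst; near=> N.
rewrite zpartialE form_suml (bigD1_seq tau) ?zwin_uniq//=; last first.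
  by rewrite mem_zwin; near: N; exact: nbhs_infty_ge.
rewrite form_suml (bigD1 b)//= formZl B_sym zx eqxx mulr1 big1 => [|c cb].
  rewrite addr0 big1 ?addr0// => s st; rewrite form_suml big1// => c _.
  by rewrite formZl B_sym zx xpair_eqE [tau == s]eq_sym (negbTE st) mulr0.
by rewrite formZl B_sym zx xpair_eqE [b == c]eq_sym (negbTE cb) andbF mulr0.
Unshelve. all: by end_near. Qed.

Lemma dual_gram_sym t a tau b : D t tau a b = D tau t b a.
Proof. by rewrite -!dual_gram B_sym. Qed.

Section FiniteSection.
Variables (n : nat) (q : 'I_p -> 'I_p -> 'I_n -> 'I_n -> R).
Hypothesis q_inv : forall a b (s t : 'I_n),
  \sum_c \sum_u q a c s u * B (x u.+1%:Z c) (x t.+1%:Z b) = ((a, s) == (b, t))%:R.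

(** The dual basis of the sample inside its own span, [q] being the inverse of the
  Gram matrix of the sample. *)
Definition dual_sect a s := \sum_c \sum_u q a c s u *: x u.+1%:Z c.
Definition dual_err a (s : 'I_n) := z s.+1%:Z a - dual_sect a s.

Lemma dual_err_orth a s b (t : 'I_n) : B (dual_err a s) (x t.+1%:Z b) = 0.
Proof.
rewrite formBl zx form_suml.
under eq_bigr do rewrite form_suml.
under eq_bigr do under eq_bigr do rewrite formZl.
rewrite q_inv !xpair_eqE andbC; apply/eqP; rewrite subr_eq0; apply/eqP.
by congr ((_ && _)%:R); rewrite -val_eqE /= eqz_nat eqSS.
Qed.

(** [dual_sect] lies in the span of the sample, to which the errors are
  orthogonal; so one of the two errors can be replaced by [z]. *)
Lemma dual_err_gram a s b t :
  B (dual_err a s) (dual_err b t) = D s.+1%:Z t.+1%:Z a b - q a b s t.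
Proof.
rewrite {2}/dual_err formBr [X in _ - X]form_sumr big1 ?subr0; last first.
  move=> c _; rewrite form_sumr big1// => u _.
  by rewrite formZr dual_err_orth mulr0.
rewrite formBl dual_gram; congr (_ - _).
rewrite form_suml (bigD1 b)//= form_suml (bigD1 t)//=.
rewrite formZl B_sym zx eqxx mulr1 big1 => [|u ut].
  rewrite addr0 big1 ?addr0// => c cb; rewrite form_suml big1// => u _.
  by rewrite formZl B_sym zx xpair_eqE [b == c]eq_sym (negbTE cb) andbF mulr0.
rewrite formZl B_sym zx xpair_eqE eqz_nat eqSS val_eqE eq_sym (negbTE ut).
by rewrite mulr0.
Qed.

Variables (L M S : R) (m : int -> int -> R).
Hypothesis upper : forall (r : seq int) (c : int -> 'I_p -> R), uniq r ->
  B (\sum_(t <- r) \sum_b c t b *: x t b) (\sum_(t <- r) \sum_b c t b *: x t b)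
    <= L * \sum_(t <- r) \sum_b c t b ^+ 2.
Hypothesis L0 : 0 <= L.
(* [m] stands for a norm of the matrices D t tau: M bounds its row sums off the
   diagonal, S the total mass that the rows of the section send outside of it. *)
Hypothesis m_dom : forall t tau a b, `|D t tau a b| <= m t tau.
Hypothesis m_row : forall t (r : seq int), uniq r -> t \notin r ->
  \sum_(tau <- r) m t tau <= M.
Hypothesis m_out : forall r : seq int, uniq r ->
  (forall tau, tau \in r -> ~~ ((0 < tau) && (tau <= n%:Z))) ->
  \sum_(s < n) \sum_(tau <- r) m s.+1%:Z tau <= S.

(** The vector is orthogonal to the sample, so its squared norm is at most that of
  any vector differing from it by an element of the span of the sample. It is
  compared with sum_s f s *: z s.+1 a minus the in-sample part of the expansion
  of that sum. The factor 2 pays for splitting off the remainder of the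
  expansion, which tends to 0. *)
Lemma dual_err_bound (a : 'I_p) (f : 'I_n -> R) (k : R) : 0 <= k ->
  (forall s, `|f s| <= k) ->
  B (\sum_s f s *: dual_err a s) (\sum_s f s *: dual_err a s)
    <= 2 * (L * (k ^+ 2 * M * S *+ p)).
Proof.
move=> k0 fk; set r := \sum_s _.
have M0 : 0 <= M by have := @m_row 0 [::] isT isT; rewrite big_nil.
have rx b (t : 'I_n) : B r (x t.+1%:Z b) = 0.
  rewrite form_suml big1// => s _; rewrite formZl dual_err_orth mulr0//.
pose u := \sum_s f s *: z s.+1%:Z a.
pose g tau b := \sum_s f s * D s.+1%:Z tau a b.
pose inn (tau : int) := (0 < tau) && (tau <= n%:Z).
pose G N := zpartial (fun tau => \sum_b g tau b *: x tau b) N.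
have uG : form_cvg G u.
  rewrite (_ : G = fun N => \sum_s f s *:
     zpartial (fun tau => \sum_b D s.+1%:Z tau a b *: x tau b) N).
    by apply: form_cvg_sum => s; exact: zD.
  apply/funext => N; rewrite /G zpartialE.
  under [RHS]eq_bigr do rewrite zpartialE scaler_sumr.
  rewrite [RHS]exchange_big/=; apply: eq_bigr => tau _.
  under [RHS]eq_bigr do rewrite scaler_sumr.
  rewrite [RHS]exchange_big/=; apply: eq_bigr => b _.
  by rewrite scaler_suml; apply: eq_bigr => s _; rewrite scalerA.
pose out N := [seq tau <- zwin N | ~~ inn tau].
have gout N : \sum_(tau <- out N) \sum_b g tau b ^+ 2 <= k ^+ 2 * M * S *+ p.
  have uo : uniq (out N) by rewrite filter_uniq ?zwin_uniq.
  have oo tau : tau \in out N -> ~~ inn tau by rewrite mem_filter => /andP[].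
  apply: le_trans (_ : \sum_(tau <- out N) \sum_(b < p)
      (k ^+ 2 * M * \sum_(s < n) m s.+1%:Z tau) <= _); last first.
    under eq_bigr do rewrite sumr_const card_ord.
    rewrite sumrMnl -mulr_sumr exchange_big/= lerMn2r; apply/orP; right.
    by rewrite ler_wpM2l ?m_out// mulr_ge0 ?exprn_ge0 ?sqr_ge0.
  rewrite big_seq [leRHS]big_seq; apply: ler_sum => tau /oo otau.
  apply: ler_sum => b _; rewrite -[leLHS]real_normK ?num_real// expr2.
  (* One factor of g^2 is bounded through column tau, the other through row tau,
     which is the same by symmetry of D; the column sums remain to be summed. *)
  have gk : `|g tau b| <= k * \sum_(s < n) m s.+1%:Z tau.
    rewrite mulr_sumr; apply: le_trans (ler_norm_sum _ _ _) _.
    by apply: ler_sum => s _; rewrite normrM ler_pM.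
  have gM : `|g tau b| <= k * M.
    apply: (@le_trans _ _ (k * \sum_(s < n) m tau s.+1%:Z)).
      rewrite mulr_sumr; apply: le_trans (ler_norm_sum _ _ _) _.
      by apply: ler_sum => s _; rewrite normrM ler_pM// dual_gram_sym m_dom.
    apply: ler_wpM2l => //.
    rewrite -(big_enum _ _ xpredT) -(big_map (fun s : 'I_n => s.+1%:Z) xpredT (m tau)).
    apply: m_row; first by rewrite map_inj_uniq ?enum_uniq// => i j [] /val_inj.
    apply: contra otau => /mapP[s _ ->]; rewrite /inn ltz_nat/= lez_nat ltn_ord//.
  rewrite mulrC (_ : k ^+ 2 * M * _ = k * M * (k * \sum_(s < n) m s.+1%:Z tau));
    last by ring.
  by rewrite mulrC ler_pM.
have rG N : B r r <= 2 * B (u - G N) (u - G N) + 2 * (L * (k ^+ 2 * M * S *+ p)).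
  pose O := \sum_(tau <- out N) \sum_b g tau b *: x tau b.
  have uo : uniq (out N) by rewrite filter_uniq ?zwin_uniq.
  have rE : B r r = B r (u - G N + O).
    have -> : u - G N + O =
       u - \sum_(tau <- zwin N | inn tau) \sum_b g tau b *: x tau b.
      rewrite /G zpartialE (bigID inn)/= /O /out big_filter.
      by rewrite opprD addrA addrNK.
    rewrite formBr [X in _ - X]form_sumr [X in _ - X]big1 ?subr0; last first.
      move=> [[|tau]|tau]//; rewrite /inn lez_nat => /andP[_ taun].
      rewrite form_sumr big1// => b _.
      by rewrite formZr (rx b (Ordinal taun)) mulr0.
    rewrite {2}/r /dual_err.
    under eq_bigr do rewrite scalerBr.
    rewrite sumrB formBr [X in _ - X]form_sumr [X in _ - X]big1 ?subr0// => s _.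
    rewrite formZr form_sumr big1 ?mulr0// => b _; rewrite form_sumr big1// => t _.
    by rewrite formZr rx mulr0.
  have le1 : B r r <= B (u - G N + O) (u - G N + O).
    have [->|r0] := eqVneq (B r r) 0; first exact: B_psd.
    have rp : 0 < B r r by rewrite lt0r r0 B_psd.
    rewrite -(ler_pM2l rp); apply: le_trans (form_CS r (u - G N + O)).
    by rewrite -rE expr2.
  apply: le_trans le1 _; apply: le_trans (form_parallelogram _ _) _.
  rewrite lerD2l ler_wpM2l//; apply: le_trans (upper _ uo) _.
  by rewrite ler_wpM2l.
rewrite leNgt; apply/negP => lt.
have e0 : 0 < (B r r - 2 * (L * (k ^+ 2 * M * S *+ p))) / 2 by rewrite divr_gt0 ?subr_gt0.
have /cvgrPdist_lt /(_ _ e0) [N _ /(_ N (leqnn _))] /= := uG.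
rewrite sub0r normrN ger0_norm ?B_psd//.
have := rG N; lra.
Qed.

(** The form of D - q is an inner product of two vectors bounded by
  [dual_err_bound], one for each side; no entrywise control of q enters. *)
Lemma inv_section_bound (a b : 'I_p) (f1 f2 : 'I_n -> R) (k : R) : 0 <= k ->
  (forall s, `|f1 s| <= k) -> (forall s, `|f2 s| <= k) ->
  `|\sum_(s < n) \sum_(t < n) f1 s * (D s.+1%:Z t.+1%:Z a b - q a b s t) * f2 t|
    <= 2 * (L * (k ^+ 2 * M * S *+ p)).
Proof.
move=> k0 f1k f2k.
set c := 2 * _.
have c1 := dual_err_bound a k0 f1k.
have c2 := dual_err_bound b k0 f2k.
set r1 := \sum_s _ in c1; set r2 := \sum_s _ in c2.
have -> : \sum_(s < n) \sum_(t < n)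
    f1 s * (D s.+1%:Z t.+1%:Z a b - q a b s t) * f2 t = B r1 r2.
  rewrite form_suml; apply: eq_bigr => s _; rewrite form_sumr.
  by apply: eq_bigr => t _; rewrite formZl formZr dual_err_gram mulrCA mulrA mulrC mulrA.
have cp : 0 <= c by apply: le_trans c1; exact: B_psd.
rewrite -(ler_pXn2r (n:=2)) ?nnegrE//.
rewrite real_normK ?num_real//; apply: le_trans (form_CS _ _) _.
by rewrite expr2 ler_pM ?B_psd.
Qed.
End FiniteSection.
End Biorthogonal.

(** * Duals and Gram matrices of a family bounded below *)

Section Spectral.
Variables (p : nat) (x : int -> 'I_p -> V) (l : R).
Hypothesis l0 : 0 < l.
Hypothesis lower : forall (r : seq int) (c : int -> 'I_p -> R), uniq r ->
  l * \sum_(t <- r) \sum_b c t b ^+ 2 <=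
  B (\sum_(t <- r) \sum_b c t b *: x t b) (\sum_(t <- r) \sum_b c t b *: x t b).

(** An innovation is a combination in which [x t a] keeps the coefficient 1, so
  the lower spectral bound applies to each of its partial sums. *)
Lemma innovation_ge (t : int) (a : 'I_p) (be : int -> 'I_p -> R) y :
  be t a = 0 -> form_cvg (zpartial (fun tau => \sum_b be tau b *: x tau b)) y ->
  l <= B (x t a - y) (x t a - y).
Proof.
move=> bta cy; pose c tau b := ((tau, b) == (t, a))%:R - be tau b.
have cc : form_cvg (zpartial (fun tau => \sum_b c tau b *: x tau b)) (x t a - y).
  apply: (form_cvg_scale (a := -1) cy); near=> N.
  rewrite scaleN1r !zpartialE.
  have -> : \sum_(tau <- zwin N) \sum_b c tau b *: x tau b =
     x t a - \sum_(tau <- zwin N) \sum_b be tau b *: x tau b.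
    under eq_bigr do under eq_bigr do rewrite scalerBl.
    under eq_bigr do rewrite sumrB.
    rewrite sumrB (bigD1_seq t) ?zwin_uniq//=; last first.
      by rewrite mem_zwin; near: N; exact: nbhs_infty_ge.
    rewrite (bigD1 a)//= eqxx scale1r big1 => [|b ba].
      rewrite addr0 big1 ?addr0// => s st; rewrite big1// => b _.
      by rewrite xpair_eqE (negbTE st) scale0r.
    by rewrite xpair_eqE (negbTE ba) andbF scale0r.
  by rewrite !opprB addrACA addrC addrA subrK addrC.
have h := form_cvg_sq cc.
rewrite -(cvg_lim (@Rhausdorff R) h); apply: limr_ge; first exact: cvgP h.
near=> N; rewrite !zpartialE; apply: le_trans (lower _ (zwin_uniq N)).
rewrite -[leLHS]mulr1 ler_pM2l// (bigD1_seq t) ?zwin_uniq//=; last first.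
  by rewrite mem_zwin; near: N; exact: nbhs_infty_ge.
rewrite (bigD1 a)//= {1}/c eqxx bta subr0 expr1n -addrA lerDl addr_ge0//.
  by rewrite sumr_ge0// => b _; rewrite sqr_ge0.
by rewrite sumr_ge0// => s _; rewrite sumr_ge0// => b _; rewrite sqr_ge0.
Unshelve. all: by end_near. Qed.

Section Dual.
Variables (y : int -> 'I_p -> V) (be : int -> 'I_p -> int -> 'I_p -> R).
Local Notation e t a := (x t a - y t a).
Hypothesis e_x : forall t a tau b, (tau, b) <> (t, a) -> B (e t a) (x tau b) = 0.
Hypothesis e_y : forall t a, B (e t a) (y t a) = 0.
Hypothesis be0 : forall t a, be t a t a = 0.
Hypothesis be_y : forall t a,
  form_cvg (zpartial (fun tau => \sum_b be tau b t a *: x tau b)) (y t a).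

Definition dual t a := (B (e t a) (e t a))^-1 *: e t a.

Lemma innovation_gt0 t a : 0 < B (e t a) (e t a).
Proof. by apply: lt_le_trans l0 _; apply: innovation_ge (be_y t a); exact: be0. Qed.

Lemma dual_biorth t a tau b : B (dual t a) (x tau b) = ((t, a) == (tau, b))%:R.
Proof.
rewrite formZl; have [[<- <-]|/eqP ne] := eqVneq (t, a) (tau, b).
  rewrite (_ : B _ (x t a) = B (e t a) (e t a)); last first.
    by rewrite formBr e_y subr0.
  rewrite mulVf//.
  by rewrite gt_eqF// innovation_gt0.
by rewrite e_x ?mulr0// => h; apply: ne.
Qed.

(** The partial sums differ from those of the projection [y t a] by the term of
  [x t a] and the factor - 1 / B (e t a) (e t a), as soon as the window
  contains [t]. *)
Lemma dual_expansion (D : int -> int -> 'M[R]_p) :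
  (forall t tau a b, D t tau a b = if (a, t) == (b, tau) then (B (e t a) (e t a))^-1
     else - be tau b t a / B (e t a) (e t a)) ->
  forall t a,
  form_cvg (zpartial (fun tau => \sum_b D t tau a b *: x tau b)) (dual t a).
Proof.
move=> DE t a; set s := (B (e t a) (e t a))^-1.
apply: (form_cvg_scale (a := - s) (be_y t a)); near=> N.
rewrite !zpartialE.
have -> : \sum_(tau <- zwin N) \sum_b D t tau a b *: x tau b =
   s *: (x t a - \sum_(tau <- zwin N) \sum_b be tau b t a *: x tau b).
  rewrite scalerBr scaler_sumr.
  rewrite !(bigD1_seq (r := zwin N) t) ?zwin_uniq//=; last 2 first.
  - by rewrite mem_zwin; near: N; exact: nbhs_infty_ge.
  - by rewrite mem_zwin; near: N; exact: nbhs_infty_ge.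
  rewrite opprD addrA; congr (_ + _).
    rewrite scaler_sumr [X in _ = _ - X](bigD1 a)//= be0 scale0r scaler0 add0r.
    rewrite (bigD1 a)//= DE eqxx.
    congr (_ + _); rewrite -sumrN; apply: eq_bigr => b ba.
    by rewrite DE xpair_eqE eq_sym (negbTE ba) scalerA -scaleNr mulNr [s * _]mulrC.
  rewrite -sumrN; apply: eq_bigr => tau taut; rewrite scaler_sumr -sumrN.
  apply: eq_bigr => b _.
  by rewrite DE xpair_eqE andbC eq_sym (negbTE taut) scalerA -scaleNr mulNr [s * _]mulrC.
rewrite /dual -scalerBr scaleNr -scalerN; congr (_ *: _).
by rewrite !opprB addrACA addrC addrA subrK addrC.
Unshelve. all: by end_near. Qed.
End Dual.


Section GramInverse.
Variable n : nat.

(** Ordered component by component, as the sample is stacked. *)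
Definition gram : 'M[R]_(\sum_(a < p) n) :=
  \mxblock_(a, b) \matrix_(s < n, t < n) B (x s.+1%:Z a) (x t.+1%:Z b).

(** A vector in the kernel is the coefficient family of an element of the span of
  the sample that is orthogonal to the sample, hence to itself. *)
Lemma gram_unit : gram \in unitmx.
Proof.
rewrite -row_free_unit; apply: inj_row_free => v v0.
pose c (t : int) b : R := if insub (`|t|%N).-1 is Some s then submxrow v b 0 s else 0.
have cE (s : 'I_n) b : c s.+1%:Z b = submxrow v b 0 s.
  by rewrite /c/= insubT//= => sn; congr (submxrow _ _ _ _); exact: val_inj.
pose r := [seq s.+1%:Z | s : 'I_n <- enum 'I_n].
have ur : uniq r by rewrite map_inj_uniq ?enum_uniq// => i j [] /val_inj.
have rE (W : nmodType) (F : int -> W) : \sum_(t <- r) F t = \sum_(s < n) F s.+1%:Z.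
  by rewrite big_map big_enum.
have orth b (t : 'I_n) :
    B (\sum_(t <- r) \sum_b c t b *: x t b) (x t.+1%:Z b) = 0.
  have := congr1 (fun w : 'rV__ => submxrow w b 0 t) v0.
  rewrite -{1}[v]submxrowK mul_mxrow_mxblock mxrowK submxrow0 mxE summxE => h.
  rewrite rE exchange_big/= form_suml -[RHS]h; apply: eq_bigr => a _.
  rewrite form_suml mxE; apply: eq_bigr => s _.
  by rewrite formZl cE !mxE.
have := lower c ur.
rewrite [X in _ <= X](_ : _ = 0); last first.
  rewrite [X in B _ X]rE form_sumr big1// => t _; rewrite form_sumr big1// => b _.
  by rewrite formZr orth mulr0.
rewrite pmulr_rle0// rE => sle0.
have sum0 : \sum_(s < n) \sum_b c s.+1%:Z b ^+ 2 = 0.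
  apply/eqP; rewrite eq_le sle0/=; apply: sumr_ge0 => s _.
  by apply: sumr_ge0 => b _; rewrite sqr_ge0.
rewrite -[v]submxrowK (eq_mxrow (fun b => _ : submxrow v b = 0)) ?mxrow0// => b.
apply/rowP => s; rewrite -cE [RHS]mxE.
move/psumr_eq0P : sum0 => /(_ _ s isT) sum0.
have {}sum0 : \sum_b c s.+1%:Z b ^+ 2 = 0.
  by apply: sum0 => i _; apply: sumr_ge0 => j _; rewrite sqr_ge0.
move/psumr_eq0P : sum0 => /(_ _ b isT) sum0.
apply/eqP; rewrite -sqrf_eq0 sum0// => j _; exact: sqr_ge0.
Qed.

Lemma gram_inv_block (a b : 'I_p) (s t : 'I_n) :
  \sum_c \sum_u submxblock (invmx gram) a c s u * B (x u.+1%:Z c) (x t.+1%:Z b) =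
  ((a, s) == (b, t))%:R.
Proof.
have := congr1 (fun A => submxblock A a b s t) (mulVmx gram_unit).
rewrite -{1}[invmx gram]submxblockK mul_mxblock mxblockK summxE.
rewrite -mxdiagZ mxblockK => h.
transitivity (\sum_k (submxblock (invmx gram) a k *m
    \matrix_(s < n, t < n) B (x s.+1%:Z k) (x t.+1%:Z b)) s t).
  apply: eq_bigr => c _; rewrite mxE; apply: eq_bigr => u _.
  by congr (_ * _); rewrite mxE.
rewrite h.
rewrite xpair_eqE; case: eqP => [_|_]; last by rewrite mxE.
by rewrite conform_mx_id mxE.
Qed.
End GramInverse.

End Spectral.
End PreHilbert.

(** * Decay off the diagonal *)

Section Decay.
Variable R : realType.

(** [rho k] is k^(3/2), the smallest weight covered by the decay hypothesis; its
  inverse is summable. *)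
Definition rho (k : nat) : R := k%:R * Num.sqrt k%:R.

Lemma rho_gt0 k : (0 < k)%N -> 0 < rho k.
Proof. by move=> k0; apply: mulr_gt0; rewrite ?sqrtr_gt0 ltr0n. Qed.

Lemma rho_le j k : (j <= k)%N -> rho j <= rho k.
Proof. by move=> jk; rewrite /rho ler_pM ?ler_nat ?ler_wsqrtr ?ler_nat. Qed.

Lemma rho_le_powR (K : R) k : 3 / 2 <= K -> (0 < k)%N -> rho k <= k%:R `^ K.
Proof.
move=> hK k0; have k1 : 1 <= k%:R :> R by rewrite ler1n.
apply: le_trans (ler_powR k1 hK).
rewrite (_ : 3 / 2 = 1 + 2^-1 :> R); last by field.
by rewrite powRD ?powRr1 ?ler0n ?powR12_sqrt// implybE orbC pnatr_eq0 -lt0n k0.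
Qed.

(** Telescoping: 1/(k+1)^(3/2) <= 2/k^(1/2) - 2/(k+1)^(1/2). *)
Lemma sum_rho n : \sum_(s < n) (rho s.+1)^-1 <= 3.
Proof.
suff : \sum_(s < n.+1) (rho s.+1)^-1 <= 3 - 2 / Num.sqrt n.+1%:R :> R.
  rewrite big_ord_recr/= => h.
  have : 0 <= (rho n.+1)^-1 by rewrite invr_ge0 ltW// rho_gt0.
  have : 0 <= 2 / Num.sqrt n.+1%:R :> R by rewrite divr_ge0// sqrtr_ge0.
  lra.
elim: n => [|n IH].
  by rewrite big_ord_recr big_ord0/= /rho sqrtr1 mul1r; lra.
rewrite big_ord_recr/=; apply: le_trans (lerD IH (lexx _)) _.
rewrite /rho.
have a0 : 0 < Num.sqrt n.+1%:R :> R by rewrite sqrtr_gt0.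
have b0 : 0 < Num.sqrt n.+2%:R :> R by rewrite sqrtr_gt0.
have aa : Num.sqrt n.+1%:R ^+ 2 = n.+1%:R :> R by rewrite sqr_sqrtr.
have bb : Num.sqrt n.+2%:R ^+ 2 = n.+2%:R :> R by rewrite sqr_sqrtr.
move: a0 b0 aa bb; set a := Num.sqrt _; set b := Num.sqrt _ => a0 b0 aa bb.
have ab : b ^+ 2 = a ^+ 2 + 1 by rewrite aa bb -(natr1 n.+1).
have ltab : a <= b by rewrite ler_wsqrtr ?ler_nat.
rewrite -bb -subr_ge0.
have -> : 3 - 2 / b - (3 - 2 / a + (b ^+ 2 * b)^-1) =
  (2 * b ^+ 2 * (b - a) - a) / (a * b ^+ 3).
  by field; rewrite !gt_eqF.
apply: divr_ge0; last by rewrite mulr_ge0 ?exprn_ge0 ?ltW.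
rewrite subr_ge0.
have e : (b - a) * (b + a) = 1 by rewrite -subr_sqr ab; ring.
have bpa : 0 < b + a by rewrite addr_gt0.
rewrite -(ler_pM2r bpa) -[X in _ <= X]mulrA e mulr1; nra.
Qed.

Lemma sum_rho_rev n : \sum_(s < n) (rho (n - s))^-1 <= 3.
Proof.
rewrite (reindex_inj rev_ord_inj)/=; apply: le_trans (sum_rho n).
by apply: ler_sum => s _; rewrite subKn.
Qed.

Variables (m : int -> int -> R) (M : R).
Hypothesis m0 : forall t tau, 0 <= m t tau.
Hypothesis mM : forall t (r : seq int), uniq r -> 0 \notin r ->
  \sum_(j <- r) rho `|j|%N * m t (t + j) <= M.

Lemma decay_bound_ge0 : 0 <= M.
Proof. by have := @mM 0 [::] isT isT; rewrite big_nil. Qed.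

(** Every weight in the sum is at least [rho d]. *)
Lemma decay_tail t (d : nat) (r : seq int) : (0 < d)%N -> uniq r ->
  (forall tau, tau \in r -> (d <= `|tau - t|)%N) ->
  \sum_(tau <- r) m t tau <= M / rho d.
Proof.
move=> d0 ur dr; rewrite ler_pdivlMr ?rho_gt0//.
pose r' := [seq tau - t | tau <- r].
have ur' : uniq r' by rewrite map_inj_uniq// => i j /addIr.
have nr : 0 \notin r'.
  by apply/mapP => -[tau /dr]; lia.
apply: le_trans (mM t ur' nr).
rewrite mulr_suml big_map big_seq [leRHS]big_seq; apply: ler_sum => tau taur.
by rewrite [t + _]addrC subrK mulrC ler_wpM2r// rho_le// dr.
Qed.

Lemma decay_row t (r : seq int) : uniq r -> t \notin r ->
  \sum_(tau <- r) m t tau <= M.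
Proof.
move=> ur tr; have : \sum_(tau <- r) m t tau <= M / rho 1.
  apply: decay_tail => // tau taur; rewrite absz_gt0 subr_eq0.
  by apply: contraNneq tr => <-.
by rewrite /rho sqrtr1 mul1r divr1.
Qed.

(** Below the sample the distance to row s+1 is at least s+1, above it at least
  n-s. *)
Lemma decay_out_row n (s : 'I_n) (r : seq int) : uniq r ->
  (forall tau, tau \in r -> ~~ ((0 < tau) && (tau <= n%:Z))) ->
  \sum_(tau <- r) m s.+1%:Z tau <= M / rho s.+1 + M / rho (n - s).
Proof.
move=> ur out; have sn := ltn_ord s.
rewrite (bigID (fun tau : int => tau <= 0))/=; apply: lerD; rewrite -big_filter.
  apply: decay_tail; rewrite ?filter_uniq// => tau.
  by rewrite mem_filter => /andP[t0 _]; lia.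
apply: decay_tail; rewrite ?filter_uniq ?subn_gt0// => tau.
by rewrite mem_filter => /andP[t0 /out]; lia.
Qed.

Lemma sum_decay n : \sum_(s < n) (M / rho s.+1 + M / rho (n - s)) <= 6 * M.
Proof.
rewrite big_split/= -!mulr_sumr.
have M0 := decay_bound_ge0.
have := ler_wpM2l M0 (sum_rho n); have := ler_wpM2l M0 (sum_rho_rev n); lra.
Qed.

Lemma decay_out n (r : seq int) : uniq r ->
  (forall tau, tau \in r -> ~~ ((0 < tau) && (tau <= n%:Z))) ->
  \sum_(s < n) \sum_(tau <- r) m s.+1%:Z tau <= 6 * M.
Proof.
move=> ur out; apply: le_trans (sum_decay n).
by apply: ler_sum => s _; exact: decay_out_row.
Qed.

End Decay.

(** * Two-sided complex series *)

Section TwoSidedSums.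
Variable R : realType.

Lemma sum_subseq_split (V : nmodType) (r r' : seq int) (F : int -> V) :
  uniq r -> uniq r' -> {subset r <= r'} ->
  \sum_(t <- r') F t =
  \sum_(t <- r) F t + \sum_(t <- [seq t <- r' | t \notin r]) F t.
Proof.
move=> ur ur' rr'; rewrite (bigID (mem r))/= big_filter; congr (_ + _).
rewrite -big_filter; apply: perm_big; apply: uniq_perm; rewrite ?filter_uniq//.
move=> t; rewrite mem_filter; apply: andb_idr; exact: rr'.
Qed.

Lemma is_cvg_zpartial_ge0 (g : int -> R) (M : R) : (forall t, 0 <= g t) ->
  (forall r : seq int, uniq r -> \sum_(t <- r) g t <= M) -> cvgn (zpartial g).
Proof.
move=> g0 gM; apply: nondecreasing_is_cvgn.
  apply/nondecreasing_seqP => N; rewrite !zpartialE.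
  rewrite (sum_subseq_split (r := zwin N) (r' := zwin N.+1)) ?zwin_uniq//.
    by rewrite lerDl sumr_ge0.
  by move=> t; rewrite !mem_zwin => /leqW.
by exists M => _ [N _ <-]; rewrite zpartialE gM ?zwin_uniq.
Qed.

(** Write g as the difference of the nonnegative |g| + g and |g|. *)
Lemma is_cvg_zpartial (g : int -> R) (M : R) :
  (forall r : seq int, uniq r -> \sum_(t <- r) `|g t| <= M) -> cvgn (zpartial g).
Proof.
move=> gM.
have -> : zpartial g =
   (fun N => zpartial (fun t => `|g t| + g t) N - zpartial (fun t => `|g t|) N).
  by apply/funext => N; rewrite !zpartialE big_split/= addrAC subrr add0r.
apply: is_cvgB; last exact: (is_cvg_zpartial_ge0 (M := M)).
apply: (is_cvg_zpartial_ge0 (M := M + M)) => [t|r ur].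
  by have := ler_norm (- g t); rewrite normrN; lra.
rewrite big_split/= lerD ?gM//; apply: le_trans (gM _ ur).
by apply: ler_sum => t _; exact: ler_norm.
Qed.

Lemma Num_conjE (z : R[i]) : Num.conj z = conjc z.
Proof. by []. Qed.

Lemma normcE (z : R[i]) : `|z| = (Normc.normc z)%:C.
Proof. by case: z. Qed.

Lemma normc_sum I (r : seq I) (P : pred I) (F : I -> R[i]) :
  Normc.normc (\sum_(i <- r | P i) F i) <= \sum_(i <- r | P i) Normc.normc (F i).
Proof.
have := ler_norm_sum r F P; rewrite normcE.
rewrite [X in _ <= X -> _](eq_bigr (fun i => (Normc.normc (F i))%:C)) => [|i _];
  last exact: normcE.
by rewrite -(rmorph_sum (real_complex R)) lecR.
Qed.

Lemma normc_ge_Re (z : R[i]) : `|complex.Re z| <= Normc.normc z.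
Proof.
case: z => a b /=; rewrite -sqrtr_sqr ler_wsqrtr// lerDl sqr_ge0//.
Qed.

Lemma normc_ge_Im (z : R[i]) : `|complex.Im z| <= Normc.normc z.
Proof.
case: z => a b /=; rewrite -sqrtr_sqr ler_wsqrtr// lerDr sqr_ge0//.
Qed.

Lemma normc_le_ReIm (z : R[i]) :
  Normc.normc z <= `|complex.Re z| + `|complex.Im z|.
Proof.
case: z => a b /=.
rewrite -[leRHS]ger0_norm ?addr_ge0// -sqrtr_sqr ler_wsqrtr//.
rewrite -[a ^+ 2]real_normK ?num_real// -[b ^+ 2]real_normK ?num_real//.
have := normr_ge0 a; have := normr_ge0 b; nra.
Qed.

Lemma cvg_complexP (u : nat -> (R[i])^o) (z : R[i]) :
  (u @ \oo --> (z : (R[i])^o)) <->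
  (forall e : R, 0 < e -> \forall N \near \oo, Normc.normc (z - u N) < e).
Proof.
split=> [h e e0|h].
  move/cvgrPdist_lt : h => /(_ e%:C).
  rewrite ltcR => /(_ e0); apply: filterS => N.
  by rewrite normcE ltcR.
apply/cvgrPdist_lt => -[e e'] /=; rewrite ltcE/= => /andP[/eqP -> e0].
by have := h e e0; apply: filterS => N; rewrite normcE ltcR.
Qed.

Section AbsolutelyConvergent.
Variables (f : int -> R[i]) (M : R).
Hypothesis fM : forall r : seq int, uniq r -> \sum_(t <- r) Normc.normc (f t) <= M.

Lemma zpartial_cvg : (zpartial f : nat -> (R[i])^o) @ \oo --> (zsum f : (R[i])^o).
Proof.
have /cvg_ex[/= a ha] : cvgn (zpartial (fun t => complex.Re (f t))).
  apply: (is_cvg_zpartial (M := M)) => r ur; apply: le_trans (fM ur).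
  by apply: ler_sum => t _; exact: normc_ge_Re.
have /cvg_ex[/= b hb] : cvgn (zpartial (fun t => complex.Im (f t))).
  apply: (is_cvg_zpartial (M := M)) => r ur; apply: le_trans (fM ur).
  by apply: ler_sum => t _; exact: normc_ge_Im.
suff h : (zpartial f : nat -> (R[i])^o) @ \oo --> (a +i* b : (R[i])^o).
  by rewrite /zsum (cvg_lim _ h).
apply/cvg_complexP => e e0.
have e2 : 0 < e / 2 by rewrite divr_gt0.
near=> N; apply: le_lt_trans (normc_le_ReIm _) _.
have hR : `|a - zpartial (fun t => complex.Re (f t)) N| < e / 2.
  by near: N; move/cvgrPdist_lt : ha; exact.
have hI : `|b - zpartial (fun t => complex.Im (f t)) N| < e / 2.
  by near: N; move/cvgrPdist_lt : hb; exact.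
move: hR hI; rewrite !zpartialE.
by rewrite !raddfB/= !raddf_sum/=; lra.
Unshelve. all: by end_near. Qed.

(** A finite partial sum approximates the series up to the mass of the terms left
  out, whatever the order of summation: eventually the symmetric window
  contains [r0], and the bound passes to the limit. *)
Lemma zsum_approx (r0 : seq int) (e : R) : uniq r0 ->
  (forall r : seq int, uniq r -> (forall t, t \in r -> t \notin r0) ->
     \sum_(t <- r) Normc.normc (f t) <= e) ->
  Normc.normc (zsum f - \sum_(t <- r0) f t) <= e.
Proof.
move=> ur0 h; rewrite leNgt; apply/negP => lt.
have d0 : 0 < Normc.normc (zsum f - \sum_(t <- r0) f t) - e by rewrite subr_gt0.
have /cvg_complexP /(_ _ d0) [N1 _ hN1] := zpartial_cvg.
have [N0 hN0] := sub_zwin r0.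
have := hN1 (maxn N0 N1) (leq_maxr _ _).
rewrite zpartialE (sum_subseq_split _ ur0 (zwin_uniq _) (hN0 _ (leq_maxl _ _))).
set w := [seq _ <- _ | _] => hh.
have hw : Normc.normc (\sum_(t <- w) f t) <= e.
  apply: le_trans (normc_sum _ _ _) _; apply: h.
    by rewrite filter_uniq ?zwin_uniq.
  by move=> t; rewrite mem_filter => /andP[].
have := ler_normD (zsum f - (\sum_(t <- r0) f t + \sum_(t <- w) f t)) (\sum_(t <- w) f t).
rewrite opprD addrA subrK !normcE -raddfD lecR.
by move: hh; rewrite opprD addrA; lra.
Qed.
End AbsolutelyConvergent.

Lemma zsum_seq (r : seq int) (f : int -> R[i]) : uniq r ->
  (forall t, t \notin r -> f t = 0) -> zsum f = \sum_(t <- r) f t.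
Proof.
move=> ur f0.
suff h : (zpartial f : nat -> (R[i])^o) @ \oo --> (\sum_(t <- r) f t : (R[i])^o).
  by rewrite /zsum (cvg_lim _ h).
have [N0 hN0] := sub_zwin r.
apply: cvg_near_cst; near=> N.
rewrite zpartialE (sum_subseq_split _ ur (zwin_uniq N)); last first.
  by apply: hN0; near: N; exact: nbhs_infty_ge.
rewrite [X in _ + X]big_seq [X in _ + X]big1 ?addr0// => t.
by rewrite mem_filter => /andP[/f0].
Unshelve. all: by end_near. Qed.

End TwoSidedSums.

(** * Spectral bounds on finitely supported vectors *)

Section SpectralBounds.
Variables (R : realType) (p : nat) (A : int -> int -> 'M[R]_p).

Definition quad (r : seq int) (c : int -> 'I_p -> R) : R :=
  \sum_(t <- r) \sum_s \sum_(tau <- r) \sum_b c t s * (A t tau s b * c tau b).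

Definition sqnorm (r : seq int) (c : int -> 'I_p -> R) : R :=
  \sum_(t <- r) \sum_s c t s ^+ 2.

Definition fin_vec (r : seq int) (c : int -> 'I_p -> R) : zvec R p :=
  fun t s => if t \in r then (c t s)%:C else 0.

Lemma sqnorm_ge0 r c : 0 <= sqnorm r c.
Proof. by apply: sumr_ge0 => t _; apply: sumr_ge0 => s _; exact: sqr_ge0. Qed.

Lemma quadform_fin r c : uniq r -> quadform A (fin_vec r c) = quad r c.
Proof.
move=> ur; rewrite /quadform /inner raddf_sum /quad exchange_big/=.
apply: eq_bigr => s _; rewrite (zsum_seq ur); last first.
  by move=> t /negbTE tr; rewrite /fin_vec tr conjC0 mul0r.
rewrite raddf_sum !big_seq; apply: eq_bigr => t tr.
rewrite /blockmul (zsum_seq ur); last first.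
  move=> tau /negbTE taur; rewrite big1// => b _.
  by rewrite /fin_vec taur mulr0.
rewrite {1}/fin_vec tr Num_conjE conjc_real mulr_sumr raddf_sum !big_seq.
apply: eq_bigr => tau taur; rewrite mulr_sumr raddf_sum; apply: eq_bigr => b _.
by rewrite /fin_vec taur -!rmorphM.
Qed.

Lemma norm2sq_fin r c : uniq r -> norm2sq (fin_vec r c) = (sqnorm r c)%:E.
Proof.
move=> ur; rewrite /norm2sq /sqnorm exchange_big/= -sumEFin; apply: eq_bigr => s _.
rewrite -sumEFin (fsbig_seq _ _ ur) -esum_fset//=; last 1 first.
- by move=> t _; rewrite lee_fin sqr_ge0.
rewrite [RHS]esum_mkcond; apply: eq_esum => t _.
rewrite /fin_vec; case: ifPn; rewrite mem_setE => tr.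
  by rewrite tr /Normc.normc/= expr0n addr0 sqr_sqrtr ?sqr_ge0.
by rewrite (negbTE tr) Normc.normc0 expr0n.
Qed.

Lemma sqnormZ a r c : sqnorm r (fun t s => a * c t s) = a ^+ 2 * sqnorm r c.
Proof.
rewrite mulr_sumr; apply: eq_bigr => t _; rewrite mulr_sumr.
by apply: eq_bigr => s _; rewrite exprMn.
Qed.

Lemma quadZ a r c : quad r (fun t s => a * c t s) = a ^+ 2 * quad r c.
Proof.
rewrite mulr_sumr; apply: eq_bigr => t _; rewrite mulr_sumr.
apply: eq_bigr => s _; rewrite mulr_sumr; apply: eq_bigr => tau _.
by rewrite mulr_sumr; apply: eq_bigr => b _; ring.
Qed.

Lemma quad_sqnorm0 r c : sqnorm r c = 0 -> quad r c = 0.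
Proof.
move=> r0; rewrite /quad big_seq big1// => t tr; apply: big1 => s _.
suff -> : c t s = 0.
  by rewrite big1// => tau _; rewrite big1// => b _; rewrite mul0r.
have : sqnorm r c == 0 by rewrite r0.
rewrite /sqnorm psumr_eq0; last first.
  by move=> i _; rewrite sumr_ge0// => j _; exact: sqr_ge0.
move/allP => /(_ _ tr); rewrite psumr_eq0; last by move=> j _; exact: sqr_ge0.
by move/allP => /(_ s); rewrite mem_index_enum sqrf_eq0 => /(_ isT)/eqP.
Qed.

(** Homogeneity reduces the comparison to finitely supported unit vectors. *)
Lemma quad_normalize r c : uniq r -> sqnorm r c != 0 -> exists2 v,
  unit_sphere v & quad r c = sqnorm r c * quadform A v.
Proof.
move=> ur n0; have np : 0 < sqnorm r c by rewrite lt0r n0 sqnorm_ge0.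
pose a := (Num.sqrt (sqnorm r c))^-1.
have aE : a ^+ 2 = (sqnorm r c)^-1 by rewrite exprVn sqr_sqrtr// ltW.
exists (fin_vec r (fun t s => a * c t s)).
  by rewrite /unit_sphere/= norm2sq_fin// sqnormZ aE mulVf.
by rewrite quadform_fin// quadZ aE mulrA mulfV// mul1r.
Qed.

(** The maximum with 0 only serves the sign of L; a supremum equal to -oo would
  leave no unit vector to compare with. *)
Lemma quad_upper : (lambda_sup A < +oo)%E -> exists2 L, 0 <= L &
  forall r c, uniq r -> quad r c <= L * sqnorm r c.
Proof.
move=> h; exists (Num.max 0 (fine (lambda_sup A))); first by rewrite le_max lexx.
move=> r c ur; have [n0|n0] := eqVneq (sqnorm r c) 0.
  by rewrite quad_sqnorm0// n0 mulr0.
have [v v1 ->] := quad_normalize ur n0.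
rewrite mulrC ler_wpM2r ?sqnorm_ge0// le_max; apply/orP; right.
have : ((quadform A v)%:E <= lambda_sup A)%E.
  by apply: ereal_sup_ubound; exists v.
by move: h; case: (lambda_sup A) => [x||]//=; rewrite lee_fin.
Qed.

(** The default 1 stands for an infimum equal to +oo, impossible once there is a
  nonzero vector. *)
Lemma quad_lower : (0 < lambda_inf A)%E -> exists2 l, 0 < l &
  forall r c, uniq r -> l * sqnorm r c <= quad r c.
Proof.
move=> h; exists (if lambda_inf A is x%:E then x else 1).
  by move: h; case: (lambda_inf A).
move=> r c ur; have [n0|n0] := eqVneq (sqnorm r c) 0.
  by rewrite quad_sqnorm0// n0 mulr0.
have [v v1 ->] := quad_normalize ur n0.
rewrite mulrC ler_wpM2l ?sqnorm_ge0//.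
have : (lambda_inf A <= (quadform A v)%:E)%E.
  by apply: ereal_inf_lbound; exists v.
by move: h; case: (lambda_inf A) => [x||]//=; rewrite lee_fin.
Qed.

End SpectralBounds.

(** * The space of centred square integrable variables *)

Section CentredSpace.
Context d (T : measurableType d) (R : realType) (P : probability T R).

Let Pfin : P setT \is a fin_num := fin_num_measure P _ measurableT.

Definition centred : {pred (T -> R)} := mem (centredL2 P).

Lemma Lfun1_centred (Y : T -> R) : centredL2 P Y -> Y \in Lfun P 1.
Proof. by move=> [Y2 _]; exact: Lfun_subset12. Qed.

Lemma centred_submod_closed : submod_closed centred.
Proof.
have [L0 LD] := @Lfun_submod_closed _ T R P 2%:E (lee1n 2).
split; first by apply: mem_set; split => //; exact: expectation_cst.
move=> a Y Z /set_mem YC /set_mem ZC; apply: mem_set; split.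
  exact: LD YC.1 ZC.1.
rewrite (_ : a *: Y + Z = (a \o* Y) \+ Z); last first.
  by apply/funext => w /=; rewrite mulrC.
have Y1 := Lfun1_centred YC; have Z1 := Lfun1_centred ZC.
by rewrite expectationD ?Lfun_scale// expectationZl// YC.2 ZC.2 mule0 adde0.
Qed.

HB.instance Definition _ := GRing.isSubmodClosed.Build R (T -> R) centred
  centred_submod_closed.

(** Functions themselves, not classes modulo almost sure equality; the covariance
  is only semidefinite on them. *)
Record cL2 := CL2 { cL2_val :> T -> R; cL2P : cL2_val \in centred }.
HB.instance Definition _ := [isSub for cL2_val].
HB.instance Definition _ := [Choice of cL2 by <:].
HB.instance Definition _ := [SubChoice_isSubLmodule of cL2 by <:].

Lemma cL2_centred (Y : cL2) : centredL2 P Y.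
Proof. exact: set_mem (cL2P Y). Qed.

Definition ccov (Y Z : cL2) : R := cov P Y Z.

Lemma ccov_sym Y Z : ccov Y Z = ccov Z Y.
Proof. by rewrite /ccov /cov covarianceC. Qed.

Lemma cL2_mul_Lfun1 (Y Z : cL2) : (Y : T -> R) * (Z : T -> R) \in Lfun P 1.
Proof. by apply: Lfun2_mul_Lfun1; [case: (cL2_centred Y)|case: (cL2_centred Z)]. Qed.

Lemma ccovE Y Z : ccov Y Z = fine 'E_P[(Y : T -> R) * (Z : T -> R)]%E.
Proof.
have YC := cL2_centred Y; have ZC := cL2_centred Z.
rewrite /ccov /cov covarianceE ?cL2_mul_Lfun1 ?Lfun1_centred//.
by rewrite YC.2 mul0e sube0.
Qed.

Lemma ccov_lin a Y1 Y2 Z : ccov (a *: Y1 + Y2) Z = a * ccov Y1 Z + ccov Y2 Z.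
Proof.
rewrite !ccovE.
rewrite (_ : ((a *: Y1 + Y2 : cL2) : T -> R) * (Z : T -> R) =
  (a \o* ((Y1 : T -> R) * (Z : T -> R))) \+ ((Y2 : T -> R) * (Z : T -> R))); last first.
  apply/funext => w.
  rewrite [LHS](_ : _ = (a * Y1 w + Y2 w) * Z w)//=.
  by rewrite mulrDl -mulrA mulrC.
have h1 := cL2_mul_Lfun1 Y1 Z; have h2 := cL2_mul_Lfun1 Y2 Z.
rewrite expectationD ?Lfun_scale// expectationZl// fineD ?fineM//.
- exact: expectation_fin_num.
- by rewrite fin_numM// expectation_fin_num.
- exact: expectation_fin_num.
Qed.

Lemma ccov_psd Y : 0 <= ccov Y Y.
Proof.
rewrite ccovE fine_ge0// expectation_ge0// => w.
by rewrite fctE -expr2 sqr_ge0.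
Qed.

End CentredSpace.

(** * Projections, innovations and inverse covariances in that space *)

Section Bridge.
Context d (T : measurableType d) (R : realType) (P : probability T R).
Variables (p : nat) (X : int -> 'I_p -> T -> R).
Hypothesis hX : forall t a, centredL2 P (X t a).

Definition cX t a : cL2 P := CL2 (mem_set (hX t a)).

Lemma cL2_sumE I (r : seq I) (Q : pred I) (Y : I -> cL2 P) (w : T) :
  (\sum_(i <- r | Q i) Y i : cL2 P) w = \sum_(i <- r | Q i) Y i w.
Proof.
by elim/big_rec2: _ => // i u v _ <-.
Qed.

Lemma ccov_cX t a tau b : ccov (cX t a) (cX tau b) = Cov_mx P X t tau a b.
Proof. by rewrite mxE. Qed.

Lemma quad_ccov (r : seq int) (c : int -> 'I_p -> R) :
  quad (Cov_mx P X) r c =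
  ccov (\sum_(t <- r) \sum_b c t b *: cX t b) (\sum_(t <- r) \sum_b c t b *: cX t b).
Proof.
have L := @ccov_lin _ _ _ P; have S := @ccov_sym _ _ _ P.
rewrite (form_suml L); apply: eq_bigr => t _; rewrite (form_suml L).
apply: eq_bigr => s _; rewrite (form_sumr L S); apply: eq_bigr => tau _.
rewrite (form_sumr L S); apply: eq_bigr => b _.
by rewrite (formZl L) (formZr L S) ccov_cX; ring.
Qed.

Lemma closed_span_gen (A : set (T -> R)) Y : A Y -> centredL2 P Y -> closed_span P A Y.
Proof.
move=> AY YC; split => // e e0; exists Y.
  exists 1%N, (fun=> 1), (fun=> Y); split => //.
  by apply/funext => w; rewrite big_ord_recl big_ord0 mul1r addr0.
pose y : cL2 P := CL2 (mem_set YC).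
rewrite (_ : cov P _ _ = ccov (y - y) (y - y)) // subrr (form0l (@ccov_lin _ _ _ P))//.
Qed.

Variables (proj : int -> 'I_p -> T -> R) (beta : int -> 'I_p -> int -> 'I_p -> R).
Hypothesis hproj : is_projection_family P X proj.
Hypothesis hbeta : is_projection_coef P X proj beta.

Lemma proj_centred t a : centredL2 P (proj t a).
Proof. by have [[]] := hproj t a. Qed.

Definition cproj t a : cL2 P := CL2 (mem_set (proj_centred t a)).

Lemma cproj_orth t a tau b : (tau, b) <> (t, a) ->
  ccov (cX t a - cproj t a) (cX tau b) = 0.
Proof.
move=> ne; have [_ h] := hproj t a; apply: h.
apply: closed_span_gen (hX tau b).
by exists (tau, b).
Qed.

Lemma cproj_orth_self t a : ccov (cX t a - cproj t a) (cproj t a) = 0.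
Proof. by have [h1 h2] := hproj t a; exact: h2. Qed.

Lemma cproj_expansion t a :
  form_cvg (@ccov _ _ _ P) (zpartial (fun tau => \sum_b beta tau b t a *: cX tau b))
    (cproj t a).
Proof.
have [_] := hbeta t a; rewrite /L2_zsum /form_cvg.
suff -> : (fun N => ccov
    (cproj t a - zpartial (fun tau => \sum_b beta tau b t a *: cX tau b) N)
    (cproj t a - zpartial (fun tau => \sum_b beta tau b t a *: cX tau b) N)) =
  (fun N => cov P
    (proj t a \- zpartial (fun tau w => \sum_b beta tau b t a * X tau b w) N)
    (proj t a \- zpartial (fun tau w => \sum_b beta tau b t a * X tau b w) N)) by [].
apply/funext => N; rewrite /ccov.
suff -> : cL2_val (cproj t a - zpartial (fun tau => \sum_b beta tau b t a *: cX tau b) N)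
  = (proj t a \- zpartial (fun tau w => \sum_b beta tau b t a * X tau b w) N) by [].
apply/funext => w /=; rewrite [LHS](_ : _ = proj t a w -
   (zpartial (fun tau => \sum_b beta tau b t a *: cX tau b) N : cL2 P) w)//.
congr (_ - _); rewrite /zpartial cL2_sumE.
rewrite [RHS](_ : _ = \sum_(i < N.*2.+1) \sum_b
    beta (i%:Z - N%:Z) b t a * X (i%:Z - N%:Z) b w).
  by apply: eq_bigr => i _; rewrite cL2_sumE.
by rewrite fct_sumE.
Qed.

Lemma sigma2_ccov t a :
  sigma2 P X proj a t = ccov (cX t a - cproj t a) (cX t a - cproj t a).
Proof.
rewrite ccovE /sigma2; by congr (fine (expectation _ _)).
Qed.

Lemma invcovE t tau a b : invcov P X proj beta t tau a b =
  if (a, t) == (b, tau) then (ccov (cX t a - cproj t a) (cX t a - cproj t a))^-1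
  else - beta tau b t a / ccov (cX t a - cproj t a) (cX t a - cproj t a).
Proof. by rewrite mxE sigma2_ccov. Qed.
End Bridge.

Lemma mx_norm_coef (R : realType) m n (A : 'M[R]_(m, n)) i j : `|A i j| <= mx_norm A.
Proof.
by rewrite mx_normrE; apply/bigmax_geP; right; exists (i, j).
Qed.

Lemma mx_norm_ge0 (R : realType) m n (A : 'M[R]_(m, n)) : 0 <= mx_norm A.
Proof. by rewrite mx_normE. Qed.

(** The smaller exponent 3/2 makes the weights explicit, and finite sums replace
  the extended-real one. *)
Lemma weighted_sum_bound (R : realType) p (D : int -> int -> 'M[R]_p) (K : R) :
  3 / 2 <= K ->
  (ereal_sup [set \esum_(j in [set j : int | j != 0%R])
        ((absz j)%:R `^ K * mx_norm (D t (t + j)))%:E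
      | t in [set: int]] < +oo)%E ->
  exists M : R, forall t (r : seq int), uniq r -> 0 \notin r ->
    \sum_(j <- r) rho R `|j|%N * mx_norm (D t (t + j)) <= M.
Proof.
move=> hK h.
pose s := ereal_sup [set \esum_(j in [set j : int | j != 0%R])
        ((absz j)%:R `^ K * mx_norm (D t (t + j)))%:E | t in [set: int]].
exists (fine s) => t r ur r0.
have : ((\sum_(j <- r) rho R `|j|%N * mx_norm (D t (t + j)))%:E <= s)%E.
  apply: (@le_trans _ _ (\esum_(j in [set j : int | j != 0%R])
        ((absz j)%:R `^ K * mx_norm (D t (t + j)))%:E)); last first.
    by apply: ereal_sup_ubound; exists t.
  apply: esum_ge; exists [set` r].
    split; first exact: finite_seq.
    by move=> j /= jr; apply: contraNneq r0 => <-.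
  rewrite -fsbig_seq// sumEFin lee_fin big_seq [leRHS]big_seq; apply: ler_sum => j jr.
  rewrite ler_wpM2r ?mx_norm_ge0// rho_le_powR// absz_gt0.
  by apply: contraNneq r0 => <-.
by move: h; rewrite -/s; case: s => [x||]//=; rewrite lee_fin.
Qed.

(** * Discrete Fourier transform of the sample *)

Section Fourier.
Variable R : realType.

Lemma cisD (x y : R) : cis (x + y) = cis x * cis y.
Proof. by rewrite /cis cosD sinD; apply/eqP; rewrite eq_complex/= eqxx addrC eqxx. Qed.

Lemma cis0 : cis 0 = 1 :> R[i].
Proof. by rewrite /cis cos0 sin0. Qed.

Lemma conj_cis (x : R) : Num.conj (cis x) = cis (- x).
Proof. by rewrite /cis cosN sinN. Qed.

Lemma normc_cis (x : R) : Normc.normc (cis x) = 1.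
Proof. by rewrite /= cos2Dsin2 sqrtr1. Qed.

Lemma cisX (x : R) n : cis x ^+ n = cis (n%:R * x).
Proof.
elim: n => [|n IH]; first by rewrite mul0r cis0.
by rewrite exprS IH -cisD -(natr1 n); congr cis; ring.
Qed.

Lemma cis_2pi (k : nat) : cis (2 * pi * k%:R) = 1 :> R[i].
Proof.
rewrite [2 * pi * _]mulrC -cisX (_ : 2 * pi = pi *+ 2 :> R); last by rewrite mulr_natl.
by rewrite /cis cos2pi sin2pi expr1n.
Qed.

(** If cos x = 1 then sin (x/2) = 0, while x/2 lies strictly between 0 and pi. *)
Lemma cis_neq1 (x : R) : 0 < x < 2 * pi -> cis x != 1.
Proof.
move=> /andP[x0 xpi]; apply/eqP => -[/eqP c1 _].
have sp : 0 < sin (x / 2).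
  by apply: sin_gt0_pi; rewrite divr_gt0//= ltr_pdivrMr// mulrC.
move: c1; rewrite (_ : x = (x / 2) *+ 2); last by rewrite mulr2n -splitr.
rewrite cos_mulr2n cos2sin2 => /eqP; move: (exprn_gt0 2 sp).
by rewrite mulr2n; lra.
Qed.

(** Orthogonality of the discrete Fourier basis: a geometric sum over the n-th
  roots of unity. *)
Lemma sum_cis_freq n (k l : 'I_n) :
  \sum_(t < n) cis (t.+1%:R * (freq R k - freq R l)) = (k == l)%:R * n%:R.
Proof.
have [<-|kl] := eqVneq k l.
  under eq_bigr do rewrite subrr mulr0 cis0.
  by rewrite sumr_const card_ord mul1r.
rewrite mul0r.
have n0 : n%:R != 0 :> R by rewrite pnatr_eq0 -lt0n; case: (n) k {l kl} => [[]|].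
pose x := freq R k - freq R l.
have c1 : cis x != 1.
  have gen (i j : 'I_n) : (j < i)%N -> cis (freq R i - freq R j) != 1.
    move=> ji; have np : 0 < n%:R :> R by rewrite lt0r n0 ler0n.
    apply: cis_neq1; rewrite /freq -mulrBl -mulrBr.
    have -> : i.+1%:R - j.+1%:R = (i - j)%:R :> R.
      by rewrite natrB ?(ltnW ji)// -!natr1; ring.
    rewrite divr_gt0 ?mulr_gt0 ?pi_gt0 ?np ?ltr0n ?subn_gt0//=.
    rewrite ltr_pdivrMr// ltr_pM2l ?mulr_gt0 ?pi_gt0// ltr_nat.
    by apply: leq_ltn_trans (leq_subr _ _) (ltn_ord i).
  have [lk|lk|/val_inj lk] := ltngtP l k.
  - exact: gen.
  - have := gen _ _ lk; apply: contra => /eqP h.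
    by rewrite -opprB -conj_cis h rmorph1.
  - by rewrite lk eqxx in kl.
have cn : cis x ^+ n = 1.
  rewrite cisX /x mulrBr cisD -conj_cis.
  have e (i : 'I_n) : n%:R * freq R i = 2 * pi * i.+1%:R.
    by rewrite /freq mulrC divfK.
  by rewrite !e !cis_2pi rmorph1 mulr1.
transitivity (cis x * \sum_(t < n) cis x ^+ t).
  by rewrite mulr_sumr; apply: eq_bigr => t _; rewrite -cisX exprS.
have /eqP := subrX1 (cis x) n.
by rewrite cn subrr eq_sym mulf_eq0 subr_eq0 (negbTE c1)/= => /eqP ->; rewrite mulr0.
Qed.

Lemma adjointM m n q (A : 'M[R[i]]_(m, n)) (B : 'M[R[i]]_(n, q)) :
  adjoint (A *m B) = adjoint B *m adjoint A.
Proof. by rewrite /adjoint trmx_mul map_mxM. Qed.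

Lemma adjointK m n (A : 'M[R[i]]_(m, n)) : adjoint (adjoint A) = A.
Proof. by apply/matrixP => i j; rewrite !mxE conjCK. Qed.

Lemma DFT_unitary n : adjoint (DFT R n) *m DFT R n = 1%:M.
Proof.
apply/matrixP => k l; rewrite mxE mxE.
have n0 : n%:R != 0 :> R by rewrite pnatr_eq0 -lt0n; case: (n) k {l} => [[]|].
transitivity (n%:R^-1 * \sum_(t < n) cis (t.+1%:R * (freq R l - freq R k)) : R[i]).
  rewrite mulr_sumr; apply: eq_bigr => t _; rewrite !mxE rmorphM/=.
  rewrite conj_cis Num_conjE conjc_real mulrACA -rmorphM -invfM -expr2.
  rewrite sqr_sqrtr ?ler0n// fmorphV rmorph_nat -cisD; congr (_ * cis _).
  by ring.
rewrite sum_cis_freq eq_sym mulrCA mulVf ?mulr1//.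
by have := fmorph_eq0 (real_complex R) n%:R; rewrite rmorph_nat => ->.
Qed.

Lemma adjoint_mxdiag p n (A : 'M[R[i]]_n) :
  adjoint (\mxdiag_(a < p) A) = \mxdiag_(a < p) adjoint A.
Proof.
apply/matrixP => i j; rewrite !mxE eq_sym.
by case: eqP => [_|_]; rewrite ?conform_mx_id !mxE ?conjC0.
Qed.

Lemma blockDFT_unitary p n :
  adjoint (blockDFT R p n) *m blockDFT R p n = 1%:M.
Proof.
rewrite /blockDFT adjoint_mxdiag {2}/mxdiag mul_mxdiag_mxblock.
rewrite -mxdiagZ /mxdiag; apply/eq_mxblock => i j.
by case: eqP => [_|_]; rewrite ?mulmx0// !conform_mx_id DFT_unitary.
Qed.

End Fourier.

Section SampleVariance.
Context d (T : measurableType d) (R : realType) (P : probability T R).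

Lemma Cexpectation_sum (I : finType) (c : I -> R[i]) (h : I -> T -> R) :
  (forall i, h i \in Lfun P 1) ->
  Cexpectation P (fun w => \sum_i c i * (h i w)%:C) =
  \sum_i c i * (fine 'E_P[h i]%E)%:C.
Proof.
move=> h1.
have key (g : I -> R) : fine 'E_P[fun w => (\sum_i g i * h i w)%R]%E =
    \sum_i g i * fine 'E_P[h i]%E.
  have [L0 LD] := @Lfun_submod_closed _ T R P 1 (lexx _).
  elim: (index_enum I) => [|i r IH].
    rewrite big_nil; under eq_fun do rewrite big_nil.
    by rewrite (expectation_cst P 0).
  rewrite big_cons -IH.
  have Lr : (fun w => \sum_(i <- r) g i * h i w) \in Lfun P 1.
    elim: (r) => [|j s IHs]; first by under eq_fun do rewrite big_nil; exact: L0.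
    by under eq_fun do rewrite big_cons; exact: LD.
  rewrite (_ : (fun w => _) = (g i \o* h i) \+ (fun w => \sum_(i <- r) g i * h i w)).
    rewrite expectationD ?Lfun_scale// expectationZl// fineD ?fineM//.
    - exact: expectation_fin_num.
    - by rewrite fin_numM// expectation_fin_num.
    - exact: expectation_fin_num.
  by apply/funext => w; rewrite big_cons/= [h i w * _]mulrC.
rewrite /Cexpectation.
have -> : (fun w => complex.Re (\sum_i c i * (h i w)%:C)) =
    (fun w => \sum_i complex.Re (c i) * h i w).
  apply/funext => w; rewrite raddf_sum; apply: eq_bigr => i _ /=.
  by case: (c i) => u v /=; ring.
have -> : (fun w => complex.Im (\sum_i c i * (h i w)%:C)) =
    (fun w => \sum_i complex.Im (c i) * h i w).
  apply/funext => w; rewrite raddf_sum; apply: eq_bigr => i _ /=.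
  by case: (c i) => u v /=; ring.
rewrite !key; apply/eqP; rewrite eq_complex/= !raddf_sum; apply/andP; split; apply/eqP;
  by apply: eq_bigr => i _ /=; case: (c i) => u v /=; ring.
Qed.

Variables (p : nat) (X : int -> 'I_p -> T -> R).
Hypothesis hX : forall t a, centredL2 P (X t a).

(** The entries of the matrix under the expectation are combinations of products
  of two observations, whose expectations are covariances as the variables are
  centred. *)
Lemma Var_linear_sample n (A : 'M[R[i]]_(\sum_(a < p) n)) :
  Var P (fun w => A *m sample X n w) =
  A *m map_mx (real_complex R) (gram (@ccov _ _ _ P) (cX hX) n) *m adjoint A.
Proof.
pose xs (i : 'I_(\sum_(a < p) n)) w := complex.Re (sample X n w i 0).
have xsE i : xs i = X (tagnat.sig2 i).+1%:Z (tagnat.sig1 i).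
  by apply/funext => w; rewrite /xs !mxE.
apply/matrixP => i j; rewrite mxE.
pose c (kl : 'I_(\sum_(a < p) n) * 'I_(\sum_(a < p) n)) :=
  A i kl.1 * adjoint A kl.2 j.
pose h (kl : 'I_(\sum_(a < p) n) * 'I_(\sum_(a < p) n)) (w : T) :=
  xs kl.1 w * xs kl.2 w.
have sE w k : sample X n w k 0 = (xs k w)%:C by rewrite /xs !mxE.
have -> : (fun w => ((A *m sample X n w) *m adjoint (A *m sample X n w)) i j) =
   (fun w => \sum_kl c kl * (h kl w)%:C).
  apply/funext => w; rewrite adjointM mxE big_ord1 !mxE big_distrlr/= pair_big/=.
  apply: eq_bigr => -[k l] _ /=; rewrite /c /h/= sE.
  rewrite [adjoint (sample _ _ _) _ _]mxE mxE sE Num_conjE conjc_real rmorphM/=.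
  by ring.
have hE kl : h kl = (cX hX (tagnat.sig2 kl.1).+1%:Z (tagnat.sig1 kl.1) : T -> R)
     * (cX hX (tagnat.sig2 kl.2).+1%:Z (tagnat.sig1 kl.2) : T -> R).
  by apply/funext => w; rewrite /h !xsE.
rewrite Cexpectation_sum; last by move=> kl; rewrite hE; exact: cL2_mul_Lfun1.
rewrite mxE; under [RHS]eq_bigr do rewrite mxE mulr_suml.
rewrite exchange_big/= pair_big/=; apply: eq_bigr => -[k l] _ /=.
rewrite hE -ccovE /c/= mulrAC; congr (_ * _ * _).
by rewrite !mxE.
Qed.

End SampleVariance.

(** * Fourier forms and averages of local spectra *)

Section FourierForm.
Variables (R : realType) (n : nat).

Definition fourier_form (e : 'I_n -> 'I_n -> R) (k1 k2 : 'I_n) : R[i] :=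
  n%:R^-1 * \sum_(s < n) \sum_(t < n)
    cis (- (s.+1%:R * freq R k1)) * (e s t)%:C * cis (t.+1%:R * freq R k2).

Lemma fourier_formB e1 e2 k1 k2 :
  fourier_form e1 k1 k2 - fourier_form e2 k1 k2 =
  fourier_form (fun s t => e1 s t - e2 s t) k1 k2.
Proof.
rewrite /fourier_form -mulrBr -sumrB; congr (_ * _); apply: eq_bigr => s _.
rewrite -sumrB; apply: eq_bigr => t _.
by rewrite rmorphB/= mulrBr mulrBl.
Qed.

Lemma fourier_form_conj e k1 k2 :
  Num.conj (fourier_form e k1 k2) = fourier_form (fun s t => e t s) k2 k1.
Proof.
rewrite /fourier_form rmorphM fmorphV rmorph_nat rmorph_sum; congr (_ * _).
under eq_bigr do rewrite rmorph_sum.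
rewrite exchange_big/=; apply: eq_bigr => t _; apply: eq_bigr => s _.
by rewrite !rmorphM/= !conj_cis opprK Num_conjE conjc_real; ring.
Qed.

Lemma normc_natV : Normc.normc (n%:R^-1 : R[i]) = n%:R^-1.
Proof.
rewrite Normc.normcV; congr (_^-1).
rewrite (_ : n%:R = (n%:R)%:C); last by rewrite rmorph_nat.
by rewrite /= expr0n addr0 sqrtr_sqr ger0_norm.
Qed.

(** Real and imaginary parts are each a combination of two real bilinear forms in
  cosines and sines, whence the factor 4. *)
Lemma fourier_form_bound e (c : R) k1 k2 :
  (forall f1 f2 : 'I_n -> R, (forall s, `|f1 s| <= 1) -> (forall s, `|f2 s| <= 1) ->
     `|\sum_(s < n) \sum_(t < n) f1 s * e s t * f2 t| <= c) ->
  Normc.normc (fourier_form e k1 k2) <= 4 * c / n%:R.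
Proof.
move=> h; rewrite Normc.normcM normc_natV mulrC ler_wpM2r ?invr_ge0//.
pose al (s : 'I_n) : R := s.+1%:R * freq R k1.
pose be (t : 'I_n) : R := t.+1%:R * freq R k2.
have c1 (g : 'I_n -> R) (s : 'I_n) : `|cos (g s)| <= 1.
  by rewrite ler_norml cos_geN1 cos_le1.
have s1 (g : 'I_n -> R) (s : 'I_n) : `|sin (g s)| <= 1.
  by rewrite ler_norml sin_geN1 sin_le1.
pose Q (f1 f2 : 'I_n -> R) := \sum_(s < n) \sum_(t < n) f1 s * e s t * f2 t.
have -> : \sum_(s < n) \sum_(t < n)
    cis (- (s.+1%:R * freq R k1)) * (e s t)%:C * cis (t.+1%:R * freq R k2) =
  (Q (cos \o al) (cos \o be) + Q (sin \o al) (sin \o be)) +i*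
  (Q (cos \o al) (sin \o be) - Q (sin \o al) (cos \o be)).
  apply/eqP; rewrite eq_complex; apply/andP; split; apply/eqP; rewrite raddf_sum.
    rewrite /= /Q -big_split/=; apply: eq_bigr => s _.
    rewrite raddf_sum -big_split/=; apply: eq_bigr => t _.
    by rewrite /al /be/= cosN sinN; ring.
  rewrite /= /Q -sumrB/=; apply: eq_bigr => s _.
  rewrite raddf_sum -sumrB/=; apply: eq_bigr => t _.
  by rewrite /al /be/= cosN sinN; ring.
apply: le_trans (normc_le_ReIm _) _ => /=.
have := h _ _ (c1 al) (c1 be); have := h _ _ (s1 al) (s1 be).
have := h _ _ (c1 al) (s1 be); have := h _ _ (s1 al) (c1 be).
rewrite -![\sum_(s < n) _]/(Q _ _).
have := ler_normD (Q (cos \o al) (cos \o be)) (Q (sin \o al) (sin \o be)).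
have := ler_normB (Q (cos \o al) (sin \o be)) (Q (sin \o al) (cos \o be)).
rewrite /comp; lra.
Qed.
End FourierForm.

Section GammaAverage.
Variables (R : realType) (p : nat) (D : int -> int -> 'M[R]_p) (M : R).
Hypothesis DM : forall t (r : seq int), uniq r -> 0 \notin r ->
  \sum_(j <- r) rho R `|j|%N * mx_norm (D t (t + j)) <= M.

Let m t tau := mx_norm (D t tau).
Let m0 t tau : 0 <= m t tau. Proof. exact: mx_norm_ge0. Qed.

Let term t (a b : 'I_p) (w : R) (r : int) : R[i] :=
  (infblock D a b t (t + r))%:C * cis (r%:~R * w).

Lemma normc_term t a b w r : Normc.normc (term t a b w r) <= m t (t + r).
Proof.
rewrite Normc.normcM normc_cis mulr1 /=.
rewrite expr0n addr0 sqrtr_sqr; exact: mx_norm_coef.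
Qed.

(** The terms of the local spectrum missing from the finite sum are those whose
  second index t + r falls outside of the sample. *)
Lemma Gamma_section n (s : 'I_n) a b w :
  Normc.normc (Gamma D s.+1%:Z a b w -
    \sum_(t < n) (D s.+1%:Z t.+1%:Z a b)%:C * cis ((t.+1%:R - s.+1%:R) * w))
    <= M / rho R s.+1 + M / rho R (n - s).
Proof.
pose r0 := [seq t.+1%:Z - s.+1%:Z | t : 'I_n <- enum 'I_n].
have -> : \sum_(t < n) (D s.+1%:Z t.+1%:Z a b)%:C * cis ((t.+1%:R - s.+1%:R) * w) =
   \sum_(j <- r0) term s.+1%:Z a b w j.
  rewrite big_map big_enum; apply: eq_bigr => t _.
  by rewrite /term /infblock [s.+1%:Z + _]addrC subrK rmorphB.
apply: (@zsum_approx _ _ (m s.+1%:Z s.+1%:Z + M)).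
- move=> r ur; apply: (@le_trans _ _ (\sum_(j <- r) m s.+1%:Z (s.+1%:Z + j))).
    by apply: ler_sum => j _; exact: normc_term.
  rewrite (bigID (fun j : int => j == 0))/=; apply: lerD.
    have [r0in|r0out] := boolP ((0 : int) \in r).
      rewrite big_mkcond (bigD1_seq _ r0in ur)/= addr0 big1 ?addr0//.
      by move=> j /negbTE ->.
    rewrite big_seq_cond big1 ?m0// => j /andP[jr /eqP j0].
    by rewrite -j0 jr in r0out.
  rewrite -big_filter -(big_map (fun j => s.+1%:Z + j) xpredT (m s.+1%:Z)).
  apply: (decay_row m0 DM).
    by rewrite map_inj_uniq ?filter_uniq// => i j /addrI.
  by apply/mapP => -[j]; rewrite mem_filter => /andP[j0 _]; lia.
- by rewrite map_inj_uniq ?enum_uniq// => i j /addIr [] /val_inj.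
move=> r ur rr0; apply: (@le_trans _ _ (\sum_(j <- r) m s.+1%:Z (s.+1%:Z + j))).
  by apply: ler_sum => j _; exact: normc_term.
rewrite -(big_map (fun j => s.+1%:Z + j) xpredT (m s.+1%:Z)).
apply: (decay_out_row m0 DM).
  by rewrite map_inj_uniq// => i j /addrI.
move=> _ /mapP[j jr ->]; apply/negP => /andP[h1 h2].
have := rr0 _ jr; apply/negP; rewrite negbK.
have tn : (`|(s.+1%:Z + j - 1)%R| < n)%N by lia.
apply/mapP; exists (Ordinal tn); first by rewrite mem_enum.
by rewrite /=; lia.
Qed.

(** Row s of the form, multiplied by a phase, is the local spectrum at time s+1
  cut to the sample; the boundary terms are summable over s. *)
Lemma Gamma_avg_section n (a b : 'I_p) (k1 k2 : 'I_n) :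
  Normc.normc (fourier_form (fun s t => D s.+1%:Z t.+1%:Z a b) k1 k2 -
    Gamma_avg D a b k1 k2) <= 6 * M / n%:R.
Proof.
rewrite /fourier_form /Gamma_avg -mulrBr -sumrB Normc.normcM normc_natV mulrC.
rewrite ler_wpM2r ?invr_ge0//; apply: le_trans (normc_sum _ _ _) _.
apply: (@le_trans _ _ (\sum_(s < n) (M / rho R s.+1 + M / rho R (n - s))));
  last exact: (sum_decay (m := m) DM).
apply: ler_sum => s _; apply: le_trans (Gamma_section s a b (freq R k2)).
rewrite (_ : _ - _ = - ((Gamma D s.+1%:Z a b (freq R k2) -
    \sum_(t < n) (D s.+1%:Z t.+1%:Z a b)%:C * cis ((t.+1%:R - s.+1%:R) * freq R k2))
   * cis (- (s.+1%:R * (freq R k1 - freq R k2))))).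
  by rewrite normcN Normc.normcM normc_cis mulr1.
rewrite mulrBl opprB mulr_suml; congr (_ - _); apply: eq_bigr => t _.
rewrite -mulrA mulrCA -mulrA -!cisD; congr (_ * cis _); ring.
Qed.

End GammaAverage.

(** * Entries of the precision matrix *)

Lemma invmx_conj (F : comUnitRingType) m (U V A : 'M[F]_m) :
  V *m U = 1%:M -> A \in unitmx -> invmx (V *m A *m U) = V *m invmx A *m U.
Proof.
move=> VU uA; have UV : U *m V = 1%:M by exact: mulmx1C.
have AB : (V *m A *m U) *m (V *m invmx A *m U) = 1%:M.
  by rewrite !mulmxA -(mulmxA _ U) UV mulmx1 -(mulmxA V) mulmxV// mulmx1.
by have [u _] := mulmx1_unit AB; rewrite -[LHS]mulmx1 -AB mulKmx.
Qed.

Section PrecisionEntries.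
Context d (T : measurableType d) (R : realType) (P : probability T R).
Variables (p : nat) (X : int -> 'I_p -> T -> R).
Hypothesis hX : forall t a, centredL2 P (X t a).
Variable n : nat.
Let G := gram (@ccov _ _ _ P) (cX hX) n.
Hypothesis G_unit : G \in unitmx.

(** The transform is unitary, so that inverting commutes with conjugating. *)
Lemma Kmx_conj : Kmx P X n =
  adjoint (blockDFT R p n) *m map_mx (real_complex R) (invmx G) *m blockDFT R p n.
Proof.
rewrite /Kmx (Var_linear_sample hX) adjointK -/G.
rewrite map_invmx; apply: invmx_conj; first exact: blockDFT_unitary.
by rewrite map_unitmx.
Qed.

Lemma Kentry_fourier (k1 k2 : 'I_n) a b :
  Kentry P X k1 k2 a b = fourier_form (submxblock (invmx G) a b) k1 k2.
Proof.
rewrite /Kentry Kmx_conj /blockDFT adjoint_mxdiag.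
rewrite -[map_mx _ _]submxblockK mul_mxdiag_mxblock mul_mxblock_mxdiag mxblockK.
rewrite mxE /fourier_form exchange_big/= mulr_sumr; apply: eq_bigr => t _.
rewrite mxE mulr_suml mulr_sumr; apply: eq_bigr => s _.
rewrite !mxE rmorphM/= conj_cis Num_conjE conjc_real.
rewrite (_ : n%:R^-1 = ((Num.sqrt n%:R)^-1)%:C * ((Num.sqrt n%:R)^-1)%:C); first by ring.
by rewrite -rmorphM -invfM -expr2 sqr_sqrtr ?ler0n// fmorphV rmorph_nat.
Qed.

Lemma gram_inv_sym a b (s t : 'I_n) :
  submxblock (invmx G) a b s t = submxblock (invmx G) b a t s.
Proof.
have sG : G^T = G.
  by apply/matrixP => i j; rewrite !mxE ccov_sym.
have sI : (invmx G)^T = invmx G by rewrite trmx_inv sG.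
by rewrite -[in RHS]sI -tr_submxblock [RHS]mxE.
Qed.

Lemma Kentry_hermitian (k1 k2 : 'I_n) a b :
  Num.conj (Kentry P X k2 k1 b a) = Kentry P X k1 k2 a b.
Proof.
rewrite !Kentry_fourier fourier_form_conj; congr (fourier_form _ _ _).
by apply/funext => s; apply/funext => t; rewrite gram_inv_sym.
Qed.
End PrecisionEntries.

Lemma normc_conj (R : realType) (z : R[i]) : Normc.normc (Num.conj z) = Normc.normc z.
Proof. by case: z => a b /=; rewrite sqrrN. Qed.

Lemma normc_split (R : realType) (x y z : R[i]) :
  Normc.normc (x - z) <= Normc.normc (x - y) + Normc.normc (y - z).
Proof.
by have := le_normcD (x - y) (y - z); rewrite addrA subrK.
Qed.

(** For a Toeplitz block the local spectra coincide and the time average is a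
  geometric sum. *)
Lemma Gamma_avg_toeplitz (R : realType) p (D : int -> int -> 'M[R]_p) a b :
  toeplitz (infblock D a b) -> forall n (k1 k2 : 'I_n),
  Gamma_avg D a b k1 k2 = (k1 == k2)%:R * Gamma D 0 a b (freq R k1).
Proof.
move=> [c hc] n k1 k2.
have GE t w : Gamma D t a b w = Gamma D 0 a b w.
  rewrite /Gamma; congr (zsum _); apply/funext => r; rewrite !hc.
  by congr ((c _)%:C * _); lia.
have n0 : n%:R != 0 :> R[i] by rewrite pnatr_eq0 -lt0n; case: (n) k1 {k2} => [[]|].
rewrite /Gamma_avg; under eq_bigr do rewrite GE.
rewrite -mulr_sumr (_ : \sum_(t < n) _ = (k1 == k2)%:R * n%:R); last first.
  rewrite eq_sym -sum_cis_freq; apply: eq_bigr => t _; congr cis; ring.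
rewrite [_ * n%:R]mulrC mulrCA mulKf// mulrC.
by case: eqP => [->|_]; rewrite ?mul0r.
Qed.

Theorem proposition4p1 (R : realType) (d : measure_display)
    (T : measurableType d) (P : probability T R)
    (p : nat) (hp : (1 <= p)%N)
    (X : int -> 'I_p -> T -> R)
    (hX : forall t a, centredL2 P (X t a))
    (hCbnd : (ereal_sup [set (mx_norm (Cov_mx P X t t))%:E | t in [set: int]]
                < +oo)%E)
    (hlambda : [/\ (0 < lambda_inf (Cov_mx P X))%E,
                   (lambda_inf (Cov_mx P X) <= lambda_sup (Cov_mx P X))%E
                 & (lambda_sup (Cov_mx P X) < +oo)%E])
    (proj : int -> 'I_p -> T -> R) (hproj : is_projection_family P X proj)
    (beta : int -> 'I_p -> int -> 'I_p -> R)
    (hbeta : is_projection_coef P X proj beta)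
    (K : R) (hK : 3 / 2 <= K)
    (hD : (ereal_sup
             [set \esum_(j in [set j : int | j != 0%R])
                    ((absz j)%:R `^ K *
                     mx_norm (invcov P X proj beta t (t + j)))%:E
              | t in [set: int]] < +oo)%E) :
  let D := invcov P X proj beta in
  (forall a b : 'I_p, exists M : R, \forall n \near \oo,
     forall k1 k2 : 'I_n,
       Normc.normc (Kentry P X k1 k2 a b - Gamma_avg D a b k1 k2)
         <= M / n%:R /\
       Normc.normc (Kentry P X k1 k2 a b - (Gamma_avg D b a k2 k1)^*)
         <= M / n%:R) /\
  (forall a b : 'I_p, cond_stationary D a b ->
     exists M : R, \forall n \near \oo, forall k1 k2 : 'I_n,
       (k1 = k2 ->
          Normc.normc (Kentry P X k1 k2 a b - Gamma D 0 a b (freq R k1))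
            <= M / n%:R) /\
       (k1 <> k2 -> Normc.normc (Kentry P X k1 k2 a b) <= M / n%:R)).
Proof.
move=> D.
have lin := @ccov_lin _ _ _ P; have sym := @ccov_sym _ _ _ P.
have psd := @ccov_psd _ _ _ P.
case: hlambda => hinf _ hsup.
have [L L0 hL] := quad_upper hsup; have [l l0 hl] := quad_lower hinf.
have upper (r : seq int) c : uniq r ->
    ccov (\sum_(t <- r) \sum_b c t b *: cX hX t b)
         (\sum_(t <- r) \sum_b c t b *: cX hX t b)
    <= L * \sum_(t <- r) \sum_b c t b ^+ 2.
  by move=> ur; rewrite -quad_ccov; exact: hL.
have lower (r : seq int) c : uniq r ->
    l * \sum_(t <- r) \sum_b c t b ^+ 2 <=
    ccov (\sum_(t <- r) \sum_b c t b *: cX hX t b)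
         (\sum_(t <- r) \sum_b c t b *: cX hX t b).
  by move=> ur; rewrite -quad_ccov; exact: hl.
have [M hM] := weighted_sum_bound hK hD; rewrite -/D in hM.
pose z := dual (@ccov _ _ _ P) (cX hX) (cproj hproj).
have zx t a tau b : ccov (z t a) (cX hX tau b) = ((t, a) == (tau, b))%:R.
  apply: (dual_biorth lin sym psd l0 lower _ _ _ (cproj_expansion hX hproj hbeta)).
  - by move=> ? ? ? ?; exact: cproj_orth.
  - by move=> ? ?; exact: cproj_orth_self.
  - by move=> t' a'; have [] := hbeta t' a'.
have zD t a : form_cvg (@ccov _ _ _ P)
    (zpartial (fun tau => \sum_b D t tau a b *: cX hX tau b)) (z t a).
  apply: (dual_expansion lin sym _ (cproj_expansion hX hproj hbeta)).
  - by move=> t' a'; have [] := hbeta t' a'.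
  - by move=> *; exact: invcovE.
have m0 t tau : 0 <= mx_norm (D t tau) by exact: mx_norm_ge0.
(* C comes from inverting the covariance of the sample, 6 * M from cutting the
   rows of D; exponentials are bounded by 1. *)
pose C := 2 * (L * (1 ^+ 2 * M * (6 * M) *+ p)).
have main (a b : 'I_p) n (k1 k2 : 'I_n) :
    Normc.normc (Kentry P X k1 k2 a b - Gamma_avg D a b k1 k2)
      <= (4 * C + 6 * M) / n%:R.
  have Gu := gram_unit lin sym l0 lower n.
  apply: le_trans (normc_split _
    (fourier_form (fun s t => D s.+1%:Z t.+1%:Z a b) k1 k2) _) _.
  rewrite mulrDl; apply: lerD; last exact: Gamma_avg_section.
  rewrite (Kentry_fourier Gu) -normcN opprB fourier_formB; apply: fourier_form_bound.
  move=> f1 f2 f1k f2k.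
  pose q a b : 'I_n -> 'I_n -> R :=
    submxblock (invmx (gram (@ccov _ _ _ P) (cX hX) n)) a b.
  have q_inv a' b' (s t : 'I_n) :
      \sum_c \sum_u q a' c s u * ccov (cX hX u.+1%:Z c) (cX hX t.+1%:Z b') =
      ((a', s) == (b', t))%:R.
    exact: (gram_inv_block lin sym l0 lower).
  apply: (inv_section_bound lin sym psd zx zD q_inv
    (m := fun t tau => mx_norm (D t tau)) upper L0 _ _ _ a b ler01 f1k f2k).
  - by move=> *; exact: mx_norm_coef.
  - by move=> t r ur tr; exact: (decay_row m0 hM).
  - by move=> r ur out; exact: (decay_out m0 hM).
split=> [a b|a b [_ _ tD]].
  exists (4 * C + 6 * M); apply: nearW => n k1 k2; split; first exact: main.
  have Gu := gram_unit lin sym l0 lower n.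
  rewrite -(Kentry_hermitian Gu) -rmorphB normc_conj; exact: main.
exists (4 * C + 6 * M); apply: nearW => n k1 k2.
have := main a b n k1 k2; rewrite Gamma_avg_toeplitz// => h.
split=> k12; move: h.
  by rewrite k12 eqxx mul1r.
by move/eqP/negbTE: k12 => ->; rewrite mul0r subr0.
Qed.
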